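(* Let $p\ge 5$ be a prime and let $\mathcal{C}$ be the curve over $\mathbb{F}_p$ with affine equation $$\frac{4(X^2-X+1)^3}{27X^2(X-1)^2}+\frac{4(Y^2-Y+1)^3}{27Y^2(Y-1)^2}=1 .$$ Let $H=(\langle\alpha_1,\alpha_2\rangle\times\langle\alpha_3,\alpha_4\rangle)\rtimes\langle\alpha_5\rangle$ be the group of automorphisms of $\mathcal{C}$ generated by $$\alpha_1:(x,y)\mapsto\Big(\frac{-1}{x-1},y\Big),\quad \alpha_2:(x,y)\mapsto\Big(\frac1x,y\Big),\quad \alpha_3:(x,y)\mapsto\Big(x,\frac{-1}{y-1}\Big),\quad \alpha_4:(x,y)\mapsto\Big(x,\frac1y\Big),\quad \alpha_5:(x,y)\mapsto(y,x).$$ Then the full automorphism group $\mathrm{Aut}(\mathcal{C})$ coincides with $H$. In particular, $\mathrm{Aut}(\mathcal{C})\cong(S_3\times S_3)\rtimes C_2$, where $C_2$ is the cyclic group of order $2$ and $S_3$ is the symmetric group on $3$ letters.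
   Context: A curve given by an affine plane equation means the projective, non-singular, geometrically irreducible algebraic curve with the corresponding function field; $\mathrm{Aut}(\mathcal{C})$ is the full group of automorphisms of $\mathcal{C}$ defined over the algebraic closure $\overline{\mathbb{F}}_p$. In the semidirect product, $\alpha_5$ interchanges the two factors $\langle\alpha_1,\alpha_2\rangle\cong S_3$ and $\langle\alpha_3,\alpha_4\rangle\cong S_3$ by conjugation. *)

(* Defs.v *)
From HB Require Import structures.
From mathcomp Require Import all_boot all_order all_algebra all_fingroup.
From mathcomp Require Import polyXY mxpoly.
From mathcomp Require Import boolp classical_sets.

Set Implicit Arguments.
Unset Strict Implicit.
Unset Printing Implicit Defensive.

Import GRing.Theory GroupScope.
Local Open Scope ring_scope.

(******************************************************************************)
(* Projective non-singular curves over an algebraically closed field K are    *)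
(* represented by their function field F, an extension of K through c. The    *)
(* points of the curve are the places of F / K, each given by its local ring  *)
(* (a valuation ring of F containing K and distinct from F).                  *)
(******************************************************************************)

Section Curve.
Variables (K F : fieldType) (c : {rmorphism K -> F}).

Record place := Place {
  local_ring :> set F;
  place_const : forall k, local_ring (c k);
  place_sub : forall f g, local_ring f -> local_ring g -> local_ring (f - g);
  place_mul : forall f g, local_ring f -> local_ring g -> local_ring (f * g);
  place_val : forall f, local_ring f \/ local_ring f^-1;
  place_proper : exists f, ~ local_ring f }.

(* An automorphism over K: a bijection of the points together with its action *)
(* f |-> f \o phi on rational functions, which identifies the local ring at   *)
(* phi P with the local ring at P (hence the regular functions on an open set *)
(* U with those on its preimage).                                             *)
Record curve_aut := CurveAut {
  point_map :> place -> place;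
  pullback : F -> F;
  point_map_bij : bijective point_map;
  pullback_bij : bijective pullback;
  pullback_add : zmod_morphism pullback;
  pullback_mul : monoid_morphism pullback;
  pullback_const : forall k, pullback (c k) = c k;
  pullback_local : forall (P : place) f,
    local_ring (point_map P) f <-> local_ring P (pullback f) }.

Lemma curve_aut_eq (a b : curve_aut) :
  point_map a = point_map b -> pullback a = pullback b -> a = b.
Proof.
case: a b => [p q h1 h2 h3 h4 h5 h6] [p' q' k1 k2 k3 k4 k5 k6] /= ep eq.
by subst p' q'; f_equal; apply: Prop_irrelevance.
Qed.

HB.instance Definition _ := gen_eqMixin curve_aut.
HB.instance Definition _ := gen_choiceMixin curve_aut.

Program Definition curve_aut_one : curve_aut :=
  @CurveAut id id _ _ _ _ _ _.
Next Obligation. by exists id. Qed.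
Next Obligation. by exists id. Qed.
Next Obligation. by []. Qed.
Next Obligation. by []. Qed.
Next Obligation. by []. Qed.

Program Definition curve_aut_mul (a b : curve_aut) : curve_aut :=
  @CurveAut (point_map a \o point_map b) (pullback b \o pullback a) _ _ _ _ _ _.
Next Obligation. by apply: bij_comp; apply: point_map_bij. Qed.
Next Obligation. by apply: bij_comp; apply: pullback_bij. Qed.
Next Obligation. by move=> f g /=; rewrite !pullback_add. Qed.
Next Obligation.
have [a1 aM] := pullback_mul a; have [b1 bM] := pullback_mul b.
by split=> [|f g] /=; rewrite ?a1 ?b1 // aM bM.
Qed.
Next Obligation. by rewrite !pullback_const. Qed.
Next Obligation. by rewrite !pullback_local. Qed.

Definition bij_inv (T : Type) (f : T -> T) (fb : bijective f) : T -> T :=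
  projT1 (cid (let: Bijective g fK gK := fb in
    ex_intro (fun g => cancel f g /\ cancel g f) g (conj fK gK))).

Lemma bij_invK T (f : T -> T) (fb : bijective f) :
  cancel f (bij_inv fb) /\ cancel (bij_inv fb) f.
Proof. by rewrite /bij_inv; case: cid. Qed.

Program Definition curve_aut_inv (a : curve_aut) : curve_aut :=
  @CurveAut (bij_inv (point_map_bij a)) (bij_inv (pullback_bij a)) _ _ _ _ _ _.
Next Obligation.
by have [? ?] := bij_invK (point_map_bij a); exists (point_map a).
Qed.
Next Obligation.
by have [? ?] := bij_invK (pullback_bij a); exists (pullback a).
Qed.
Next Obligation.
have [aK Ka] := bij_invK (pullback_bij a); move=> f g.
by apply: (can_inj aK); rewrite pullback_add !Ka.
Qed.
Next Obligation.
have [aK Ka] := bij_invK (pullback_bij a); have [a1 aM] := pullback_mul a.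
by split=> [|f g]; apply: (can_inj aK); rewrite ?aM !Ka ?a1.
Qed.
Next Obligation.
have [aK Ka] := bij_invK (pullback_bij a).
by apply: (can_inj aK); rewrite pullback_const Ka.
Qed.
Next Obligation.
have [aK Ka] := bij_invK (pullback_bij a).
have [pK Kp] := bij_invK (point_map_bij a).
by rewrite -{2}[P]Kp pullback_local Ka.
Qed.

Lemma curve_aut_mulA : associative curve_aut_mul.
Proof. by move=> a b d; apply: curve_aut_eq. Qed.

Lemma curve_aut_1mul : left_id curve_aut_one curve_aut_mul.
Proof. by move=> a; apply: curve_aut_eq. Qed.

Lemma curve_aut_mul1 : right_id curve_aut_one curve_aut_mul.
Proof. by move=> a; apply: curve_aut_eq. Qed.

Lemma curve_aut_Vmul : left_inverse curve_aut_one curve_aut_inv curve_aut_mul.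
Proof.
move=> a; have [aK Ka] := bij_invK (pullback_bij a).
have [pK Kp] := bij_invK (point_map_bij a).
by apply: curve_aut_eq; apply: funext => z /=; rewrite ?pK ?Ka.
Qed.

Lemma curve_aut_mulV : right_inverse curve_aut_one curve_aut_inv curve_aut_mul.
Proof.
move=> a; have [aK Ka] := bij_invK (pullback_bij a).
have [pK Kp] := bij_invK (point_map_bij a).
by apply: curve_aut_eq; apply: funext => z /=; rewrite ?aK ?Kp.
Qed.

HB.instance Definition _ := isGroup.Build curve_aut
  curve_aut_mulA curve_aut_1mul curve_aut_mul1 curve_aut_Vmul curve_aut_mulV.

(* phi : (x, y) |-> (u, v), for rational functions x, y, u, v on the curve *)
Definition maps_to (x y : F) (phi : curve_aut) (u v : F) : Prop :=
  pullback phi x = u /\ pullback phi y = v.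

(* F = K(x, y) is the function field of the plane curve below, with x and y   *)
(* the coordinate functions. Outside characteristics 2 and 3, as x is         *)
(* transcendental over K, the relation forces x and y to differ from 0 and 1, *)
(* so that no denominator vanishes.                                           *)
Record is_function_field (x y : F) : Prop := IsFunctionField {
  coord_transcendental : ~ algebraicOver c x;
  coord_equation :
    4%:R * (x ^+ 2 - x + 1) ^+ 3 / (27%:R * x ^+ 2 * (x - 1) ^+ 2)
    + 4%:R * (y ^+ 2 - y + 1) ^+ 3 / (27%:R * y ^+ 2 * (y - 1) ^+ 2) = 1;
  coord_generate : forall z : F, exists g h : {poly {poly K}},
    (map_poly (map_poly c) h).[x, y] != 0 /\
    z = (map_poly (map_poly c) g).[x, y] / (map_poly (map_poly c) h).[x, y] }.

End Curve.

Section Groups.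
Local Open Scope group_scope.
Local Open Scope classical_set_scope.

Definition isomorphic (G H : groupType) : Prop :=
  exists2 f : G -> H, bijective f & {morph f : a b / a * b}.

Definition is_subgroup (G : groupType) (H : set G) : Prop :=
  H 1 /\ forall a b, H a -> H b -> H (a * b^-1).

Definition subgroup_gen (G : groupType) (S : set G) : set G :=
  smallest (@is_subgroup G) S.

Definition prod_set (G : groupType) (A B : set G) : set G :=
  [set g | exists a b, [/\ A a, B b & g = a * b]].

(* H is the internal direct product A x B, resp. semidirect product N >< Q *)
Definition internal_dprod (G : groupType) (A B H : set G) : Prop :=
  [/\ is_subgroup A, is_subgroup B,
      forall a b, A a -> B b -> commute a b,
      A `&` B = [set 1] & prod_set A B = H].

Definition internal_sdprod (G : groupType) (N Q H : set G) : Prop :=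
  [/\ is_subgroup N, is_subgroup Q,
      forall n q, N n -> Q q -> N (n ^ q),
      N `&` Q = [set 1] & prod_set N Q = H].

End Groups.

Section Swap.
Local Open Scope group_scope.
Local Notation S3xS3 := ('S_3 * 'S_3)%type.

(* the cyclic group 'Z_2 acting on S_3 x S_3 by exchanging the two factors; *)
(* 1%g is its neutral element, that is, the residue class of 0                *)
Definition swap_act (u : S3xS3) (a : 'Z_2) : S3xS3 :=
  if a == 1%g then u else (u.2, u.1).

Lemma swap_is_action : is_action [set: 'Z_2] swap_act.
Proof.
split=> [a u v|u a b _ _]; rewrite /swap_act.
  by case: ifP => // _; case: u v => [u1 u2] [v1 v2] [-> ->].
by case: u => u1 u2; case: a => [[|[|[]]] ?] //; case: b => [[|[|[]]] ?].
Qed.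
Canonical swap_action := Action swap_is_action.

Lemma swap_is_groupAction : is_groupAction [set: S3xS3] swap_action.
Proof.
move=> a _; rewrite inE; apply/andP; split.
  by apply/fintype.subsetP=> u _; rewrite inE.
apply/morphicP=> u v _ _; rewrite !actpermE /= /swap_act.
by case: ifP.
Qed.
Canonical swap_groupAction := GroupAction swap_is_groupAction.

Definition S3xS3_C2 := sdprod_by swap_groupAction.
End Swap.

(* Main.v *)
Require Import Defs.
From HB Require Import structures.
From mathcomp Require Import all_boot all_order all_algebra all_fingroup.
From mathcomp Require Import polyXY mxpoly.
From mathcomp Require Import boolp classical_sets.
From mathcomp Require Import ring zify.

Set Implicit Arguments.
Unset Strict Implicit.
Unset Printing Implicit Defensive.

Import GRing.Theory.
Local Open Scope ring_scope.

(** Why the theorem holds. Let w be a primitive cube root of unity. In the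
    coordinate a = (x + w) / (x + w^2) the six substitutions generated by
    x -> 1/x and x -> -1/(x-1) become a -> w^i a and a -> w^i / a, and the
    invariant 4 (x^2-x+1)^3 / (27 x^2 (x-1)^2) becomes -4 a^3 / (a^3-1)^2. With b
    the same coordinate of y, the curve equation makes -a and -b squares in the
    function field, say of u and v, and turns into (1 + u^3) (1 + v^3) = 2
    ([angle_curve], [coords_curve_pair]). So the curve is a smooth curve of
    bidegree (3, 3) on a quadric. Its holomorphic differentials are
    (k0 + k1 u + k2 v + k3 u v) times a fixed one, and an automorphism permutes
    them linearly; the relation 1 * uv = u * v then forces it to preserve the two
    rulings of the quadric. Hence it sends u and v to fractional linear functions
    of u and of v, or the other way round, and comparing with the equation shows
    that v^6 goes to v^6, u^6 or the inverse of one of them. The invariant of y is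
    4 v^6 / (1 + v^6)^2, so an automorphism sends it to itself or to the invariant
    of x. The six functions of x with a given invariant form one orbit of the
    symmetric group S_3, so every automorphism is one of the 72 visible ones.

    The steps that carry this argument are the following.

    - [quad_eq0]: 1, u, u^2 are linearly independent over K(v), because
      (1 - v^3) / (1 + v^3) is not a cube; the norm form [cubic_norm] of the
      extension has no nontrivial zero. Consequently any two pairs of generators
      that satisfy the equation differ by an automorphism ([coord_aut]).

    - Differentials are handled through the derivation D dual to the holomorphic
      differential dv / (-u^2 (1 + v^3)). A function k represents a holomorphic
      differential when, for every place P and every h such that h D maps the
      local ring of P into itself, h k belongs to that local ring ([regular]).
      This formulation mentions no uniformizer, and it is visibly compatible
      with automorphisms up to the factor by which they multiply D
      ([regular_pullback]).

    - [basis_regular] and [regular_form] identify the regular functions with the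
      span of 1, u, v, uv. The first is checked at an arbitrary place; the second
      only needs the places of the affine points, which are the explicit local
      rings of [point_place], because the automorphisms (1/u, -v) and (-u, 1/v)
      bring the points at infinity to finite distance.

    - [aut_mobius_pair], [sixth_power], [aut_jinv] and [jinv_fiber] carry out the
      end of the argument, and [aut_classification] lists the automorphisms. *)

(** * Evaluation of polynomials in one and two variables *)

Section Evaluation.
Variables (K : fieldType) (L : fieldType) (f : {rmorphism K -> L}) (u v : L).

Definition ev1 (a : {poly K}) : L := (map_poly f a).[v].
(* The outer variable of a bivariate polynomial goes to u, the inner one to v. *)
Definition ev (G : {poly {poly K}}) : L := (map_poly (map_poly f) G).[u, v].

Lemma ev1_zmod : zmod_morphism ev1.
Proof. by move=> a b; rewrite /ev1 rmorphB hornerD hornerN. Qed.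
Lemma ev1_monoid : monoid_morphism ev1.
Proof. by split=> [|a b]; rewrite /ev1 ?rmorph1 ?hornerC // rmorphM hornerM. Qed.
HB.instance Definition _ := GRing.isZmodMorphism.Build {poly K} L ev1 ev1_zmod.
HB.instance Definition _ := GRing.isMonoidMorphism.Build {poly K} L ev1 ev1_monoid.

Lemma ev_zmod : zmod_morphism ev.
Proof. by move=> a b; rewrite /ev rmorphB !hornerD !hornerN. Qed.
Lemma ev_monoid : monoid_morphism ev.
Proof. by split=> [|a b]; rewrite /ev ?rmorph1 ?hornerC // rmorphM !hornerM. Qed.
HB.instance Definition _ := GRing.isZmodMorphism.Build {poly {poly K}} L ev ev_zmod.
HB.instance Definition _ :=
  GRing.isMonoidMorphism.Build {poly {poly K}} L ev ev_monoid.

Lemma ev1C k : ev1 k%:P = f k. Proof. by rewrite /ev1 map_polyC hornerC. Qed.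
Lemma ev1X : ev1 'X = v. Proof. by rewrite /ev1 map_polyX hornerX. Qed.
Lemma evC a : ev a%:P = ev1 a.
Proof. by rewrite /ev map_polyC hornerC. Qed.
Lemma evX : ev 'X = u. Proof. by rewrite /ev map_polyX hornerX hornerC. Qed.
Lemma ev1D : {morph ev1 : a b / a + b}. Proof. exact: rmorphD. Qed.
Lemma ev1N : {morph ev1 : a / - a}. Proof. exact: rmorphN. Qed.
Lemma ev1B : {morph ev1 : a b / a - b}. Proof. exact: rmorphB. Qed.
Lemma ev1M : {morph ev1 : a b / a * b}. Proof. exact: rmorphM. Qed.
Lemma ev1Xn n : {morph ev1 : a / a ^+ n}. Proof. exact: rmorphXn. Qed.
Lemma ev1Mn n : {morph ev1 : a / a *+ n}. Proof. exact: rmorphMn. Qed.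
Lemma ev1_0 : ev1 0 = 0. Proof. exact: rmorph0. Qed.
Lemma ev1_1 : ev1 1 = 1. Proof. exact: rmorph1. Qed.
Lemma evD : {morph ev : a b / a + b}. Proof. exact: rmorphD. Qed.
Lemma evN : {morph ev : a / - a}. Proof. exact: rmorphN. Qed.
Lemma evB : {morph ev : a b / a - b}. Proof. exact: rmorphB. Qed.
Lemma evM : {morph ev : a b / a * b}. Proof. exact: rmorphM. Qed.
Lemma evXn n : {morph ev : a / a ^+ n}. Proof. exact: rmorphXn. Qed.
Lemma ev_0 : ev 0 = 0. Proof. exact: rmorph0. Qed.
Lemma ev_1 : ev 1 = 1. Proof. exact: rmorph1. Qed.
Definition evE := (ev_0, ev_1, ev1_0, ev1_1, evX, evC, ev1X, ev1C).
(* Keyed on ev1 and ev: the generic morphism rules match too many terms here. *)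
Definition evME := (ev1Mn, ev1Xn, ev1B, ev1D, ev1N, ev1M, evXn, evB, evD, evN, evM).

End Evaluation.

Lemma ev_swap (K L : fieldType) (f : {rmorphism K -> L}) u v G :
  ev f u v (swapXY G) = ev f v u G.
Proof. by rewrite /ev -swapXY_map horner2_swapXY. Qed.

Lemma ev1_root (K L : fieldType) (f : {rmorphism K -> L}) al a :
  ev1 f (f al) a = f a.[al].
Proof. by rewrite /ev1 horner_map. Qed.

(** * Generators of the function field and the cubic equation *)

(** The model of the curve on which the proof runs: bidegree (3, 3) in the product
    of two projective lines, smooth and of genus 4. *)
Definition on_curve (L : fieldType) (u v : L) := (1 + u ^+ 3) * (1 + v ^+ 3) = 2%:R.

Section CurvePair.
Variables (K : closedFieldType) (F : fieldType) (c : {rmorphism K -> F}).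
Hypothesis two_neq0 : (2%:R : K) != 0.
Hypothesis three_neq0 : (3%:R : K) != 0.

Definition in_const (z : F) : Prop := exists k, z = c k.

(** Stability under subtraction, multiplication and inversion suffices; with the
    constants it makes S a subfield of F containing K. *)
Definition closed_subfield (S : F -> Prop) : Prop :=
  [/\ forall k, S (c k), forall z t, S z -> S t -> S (z - t),
      forall z t, S z -> S t -> S (z * t) & forall z, S z -> S z^-1].

(** F = K(u, v), in the form of an induction principle. *)
Definition generates (u v : F) : Prop :=
  forall S, closed_subfield S -> S u -> S v -> forall z, S z.

Record curve_pair (u v : F) : Prop := CurvePair {
  cp_nonconst : ~ in_const v;
  cp_eqn : on_curve u v;
  cp_gen : generates u v }.

Lemma two_neq0F : (2%:R : F) != 0.
Proof. by rewrite -(rmorph_nat c) fmorph_eq0. Qed.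
Lemma three_neq0F : (3%:R : F) != 0.
Proof. by rewrite -(rmorph_nat c) fmorph_eq0. Qed.

Section SubfieldClosure.
Variables (S : F -> Prop) (Ssub : closed_subfield S).
Lemma sfC k : S (c k). Proof. by case: Ssub. Qed.
Lemma sfB z t : S z -> S t -> S (z - t). Proof. by case: Ssub => _ + _ _; apply. Qed.
Lemma sfM z t : S z -> S t -> S (z * t). Proof. by case: Ssub => _ _ + _; apply. Qed.
Lemma sfV z : S z -> S z^-1. Proof. by case: Ssub => _ _ _; apply. Qed.
Lemma sf1 : S 1. Proof. by rewrite -(rmorph1 c); apply: sfC. Qed.
Lemma sfN z : S z -> S (- z).
Proof. by move=> Sz; rewrite -sub0r -(rmorph0 c); apply: sfB => //; apply: sfC. Qed.
Lemma sfD z t : S z -> S t -> S (z + t).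
Proof. by move=> Sz St; rewrite -[t]opprK; apply: sfB => //; apply: sfN. Qed.
Lemma sfX z i : S z -> S (z ^+ i).
Proof.
move=> Sz; elim: i => [|i IH]; first by rewrite expr0; apply: sf1.
by rewrite exprS; apply: sfM.
Qed.
End SubfieldClosure.

Lemma const_subfield : closed_subfield in_const.
Proof.
split=> [k|_ _ [k ->] [l ->]|_ _ [k ->] [l ->]|_ [k ->]]; first by exists k.
- by exists (k - l); rewrite rmorphB.
- by exists (k * l); rewrite rmorphM.
by exists k^-1; rewrite fmorphV.
Qed.

(** K is algebraically closed in F: a polynomial over K splits, so an element of F
    that satisfies one is among its roots. *)
Lemma ev1_eq0_const v a : a != 0 -> ev1 c v a = 0 -> in_const v.
Proof.
move=> a0; have [r Ea] := closed_field_poly_normal a.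
rewrite Ea -mul_polyC rmorphM rmorph_prod /= ev1C => /eqP.
rewrite mulf_eq0 fmorph_eq0 lead_coef_eq0 (negPf a0) /=.
rewrite prodf_seq_eq0 => /hasP [k _]; rewrite rmorphB /= ev1X ev1C subr_eq0.
by move/eqP->; exists k.
Qed.

Lemma const_root z i : (0 < i)%N -> in_const (z ^+ i) -> in_const z.
Proof.
move=> i0 [k Ek]; apply: (@ev1_eq0_const z ('X^i - k%:P)).
  by rewrite -size_poly_eq0 size_XnsubC.
by rewrite rmorphB rmorphXn /= ev1X ev1C Ek subrr.
Qed.

Lemma cp_gen_swap u v : generates u v -> generates v u.
Proof. by move=> g S Ss Su Sv z; apply: (g S). Qed.

Lemma cp_neq u v : curve_pair u v -> 1 + u ^+ 3 != 0 /\ 1 + v ^+ 3 != 0.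
Proof.
move=> h; have := two_neq0F; rewrite -(cp_eqn h) mulf_eq0 negb_or.
by case/andP.
Qed.

(** If u were constant, the equation would make v^3, hence v, constant. *)
Lemma cp_swap u v : curve_pair u v -> curve_pair v u.
Proof.
move=> h; split; [|by rewrite /on_curve mulrC; apply: cp_eqn|exact: cp_gen_swap (cp_gen h)].
have CS := const_subfield; have [u0 v0] := cp_neq h.
move=> cu; apply: (cp_nonconst h); apply: (@const_root _ 3) => //.
have -> : v ^+ 3 = 2%:R / (1 + u ^+ 3) - 1.
  by rewrite -(cp_eqn h) mulrAC mulfV // mul1r addrC addKr.
apply: (sfB CS); last exact: sf1.
apply: (sfM CS); first by exists 2%:R; rewrite rmorph_nat.
by apply: (sfV CS); apply: (sfD CS); [exact: sf1|exact: sfX].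
Qed.

End CurvePair.

(** * The cubic extension K(v, u) of K(v) *)

Section CubicNorm.
Variables (K : closedFieldType) (F : fieldType) (c : {rmorphism K -> F}).
Hypothesis two_neq0 : (2%:R : K) != 0.
Hypothesis three_neq0 : (3%:R : K) != 0.

Definition polP : {poly K} := 1 + 'X ^+ 3.
Definition polM : {poly K} := 1 - 'X ^+ 3.
(** (1 + v^3)^2 times the norm of a0 + a1 u + a2 u^2 from K(v, u) to K(v), where
    u^3 = (1 - v^3) / (1 + v^3). *)
Definition cubic_norm (a0 a1 a2 : {poly K}) : {poly K} :=
  a0 ^+ 3 * polP ^+ 2 + a1 ^+ 3 * polM * polP + a2 ^+ 3 * polM ^+ 2
  - a0 * a1 * a2 * polM * polP *+ 3.

Lemma root_factor (p : {poly K}) al : p.[al] = 0 -> exists q, p = ('X - al%:P) * q.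
Proof.
by move=> /eqP/factor_theorem [q ->]; exists q; rewrite mulrC.
Qed.

(** At 1 the polynomial 1 - 'X^3 vanishes to order one and 1 + 'X^3 does not, so the
    first three terms have orders 0, 1, 2 modulo 3, while the order of the last one
    is the mean of these: the term of least order is not cancelled. The proof is the
    corresponding descent, dividing a0, a1 and a2 by 'X - 1 in turn. *)
Lemma cubic_norm_eq0 a0 a1 a2 :
  cubic_norm a0 a1 a2 = 0 -> [/\ a0 = 0, a1 = 0 & a2 = 0].
Proof.
pose E : {poly K} := 'X - 1%:P; have E0 : E != 0 by rewrite polyXsubC_eq0.
pose M1 : {poly K} := - (1 + 'X + 'X ^+ 2).
have DM : polM = E * M1 by rewrite /polM /E /M1 polyC1; ring.
have E1 : E.[1] = 0 by rewrite /E !hornerE subrr.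
have M11 : M1.[1] = - 3%:R by rewrite /M1 !hornerE; ring.
have P1 : polP.[1] = 2%:R by rewrite /polP !hornerE; ring.
have szE (b : {poly K}) : b != 0 -> size (E * b) = (size b).+1.
  by move=> b0; rewrite mulrC size_Mmonic ?monicXsubC // size_XsubC addn2.
have szE' (b : {poly K}) : (size b <= size (E * b)%R)%N.
  by have [->|/szE ->] := eqVneq b 0; rewrite ?mulr0 ?size_poly0 // ltnW.
have DE : E = 'X - 1%:P by [].
rewrite /cubic_norm; move: polP P1 DM => P P1; move: polM => M DM.
clearbody E M1; subst M.
have [n] := ubnP (size a0 + size a1 + size a2)%N.
elim: n a0 a1 a2 => // n IH a0 a1 a2 len N0.
have /root_factor [b0 Eb0] : a0.[1] = 0.
  have := congr1 (horner^~ 1) N0;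
  rewrite !(hornerD, hornerN, hornerM, hornerMn, horner_exp, horner0) E1 P1 => h.
  have /eqP : a0.[1] ^+ 3 * 2%:R ^+ 2 = 0 by rewrite -[RHS]h; ring.
  by rewrite mulf_eq0 !expf_eq0 (negPf two_neq0) orbF => /eqP.
have N1 : E ^+ 2 * b0 ^+ 3 * P ^+ 2 + a1 ^+ 3 * M1 * P
    + E * a2 ^+ 3 * M1 ^+ 2 - E * b0 * a1 * a2 * M1 * P *+ 3 = 0.
  by apply: (mulfI E0); rewrite mulr0 -[RHS]N0 Eb0 -DE; ring.
have /root_factor [b1 Eb1] : a1.[1] = 0.
  have := congr1 (horner^~ 1) N1;
  rewrite !(hornerD, hornerN, hornerM, hornerMn, horner_exp, horner0) E1 P1 M11 => h.
  have /eqP : a1.[1] ^+ 3 * (2%:R * 3%:R) = 0 by rewrite -[RHS]oppr0 -h; ring.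
  by rewrite !(mulf_eq0, expf_eq0) (negPf two_neq0) (negPf three_neq0) /= !orbF !orbb => /eqP.
have N2 : E * b0 ^+ 3 * P ^+ 2 + E ^+ 2 * b1 ^+ 3 * M1 * P
    + a2 ^+ 3 * M1 ^+ 2 - E * b0 * b1 * a2 * M1 * P *+ 3 = 0.
  by apply: (mulfI E0); rewrite mulr0 -[RHS]N1 Eb1 -DE; ring.
have /root_factor [b2 Eb2] : a2.[1] = 0.
  have := congr1 (horner^~ 1) N2;
  rewrite !(hornerD, hornerN, hornerM, hornerMn, horner_exp, horner0) E1 P1 M11 => h.
  have /eqP : a2.[1] ^+ 3 * 3%:R ^+ 2 = 0 by rewrite -[RHS]h; ring.
  by rewrite mulf_eq0 !expf_eq0 (negPf three_neq0) orbF => /eqP.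
have N3 : b0 ^+ 3 * P ^+ 2 + b1 ^+ 3 * (E * M1) * P + b2 ^+ 3 * (E * M1) ^+ 2
    - b0 * b1 * b2 * (E * M1) * P *+ 3 = 0.
  by apply: (mulfI E0); rewrite mulr0 -[RHS]N2 Eb2 -DE; ring.
have [b00|b00] := eqVneq b0 0; last have s0 := szE _ b00.
  have [b10|b10] := eqVneq b1 0; last have s1 := szE _ b10.
    have [b20|b20] := eqVneq b2 0; last have s2 := szE _ b20.
      by rewrite Eb0 Eb1 Eb2 b00 b10 b20 !mulr0.
all: have [|Z0 Z1 Z2] := IH b0 b1 b2 _ N3; last by rewrite Eb0 Eb1 Eb2 Z0 Z1 Z2 !mulr0.
all: move: len (szE' b0) (szE' b1) (szE' b2).
all: rewrite Eb0 Eb1 Eb2 -DE ?s0 ?s1 ?s2.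
all: move: (size (E * b0)%R) (size (E * b1)%R) (size (E * b2)%R).
all: by move: (size b0) (size b1) (size b2); lia.
Qed.
End CubicNorm.

Import Pdiv.ComRing Pdiv.Ring.
Section CubicExtension.
Variables (K : closedFieldType) (F : fieldType) (c : {rmorphism K -> F}).
Hypothesis two_neq0 : (2%:R : K) != 0.
Hypothesis three_neq0 : (3%:R : K) != 0.

Lemma ev1_polP (L : fieldType) (f : {rmorphism K -> L}) v : ev1 f v (polP K) = 1 + v ^+ 3.
Proof. by rewrite /polP !evME !evE. Qed.
Lemma ev1_polM (L : fieldType) (f : {rmorphism K -> L}) v : ev1 f v (polM K) = 1 - v ^+ 3.
Proof. by rewrite /polM !evME !evE. Qed.

Definition quad (a0 a1 a2 : {poly K}) : {poly {poly K}} :=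
  a0%:P + a1%:P * 'X + a2%:P * 'X ^+ 2.

Lemma ev_quad (L : fieldType) (f : {rmorphism K -> L}) u v a0 a1 a2 :
  ev f u v (quad a0 a1 a2) = ev1 f v a0 + ev1 f v a1 * u + ev1 f v a2 * u ^+ 2.
Proof. by rewrite /quad !evME !evE. Qed.

(** The product of the two conjugates of a0 + a1 u + a2 u^2, up to (1 + v^3)^2. *)
Definition cofactor (a0 a1 a2 : {poly K}) : {poly {poly K}} :=
  quad (a0 ^+ 2 * (polP K) ^+ 2 - a1 * a2 * (polM K) * (polP K))
       (a2 ^+ 2 * (polM K) * (polP K) - a0 * a1 * (polP K) ^+ 2)
       (a1 ^+ 2 * (polP K) ^+ 2 - a0 * a2 * (polP K) ^+ 2).

Lemma on_curve_cube (L : fieldType) (u v : L) :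
  on_curve u v -> (1 + v ^+ 3) * u ^+ 3 = 1 - v ^+ 3.
Proof.
move=> h; transitivity ((1 + u ^+ 3) * (1 + v ^+ 3) - (1 + v ^+ 3)); first by ring.
by rewrite h; ring.
Qed.

Lemma quad_norm (L : fieldType) (f : {rmorphism K -> L}) u v a0 a1 a2 : on_curve u v ->
  ev f u v (quad a0 a1 a2) * ev f u v (cofactor a0 a1 a2)
  = ev1 f v (cubic_norm a0 a1 a2).
Proof.
move=> /on_curve_cube; rewrite /cofactor !ev_quad /cubic_norm.
move: (polP K) (ev1_polP f v) (polM K) (ev1_polM f v) => P <- M <- E.
by rewrite !evME -E; ring.
Qed.

Definition curve_poly : {poly {poly K}} := (polP K)%:P * 'X ^+ 3 - (polM K)%:P.

Lemma ev_curve_poly (L : fieldType) (f : {rmorphism K -> L}) u v :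
  on_curve u v -> ev f u v curve_poly = 0.
Proof.
move=> /on_curve_cube E; rewrite /curve_poly !evME !evE.
by rewrite ev1_polP ev1_polM E subrr.
Qed.

Lemma polP_neq0 : (polP K) != 0.
Proof.
by apply/eqP => /(congr1 (fun p : {poly K} => p`_0)) /eqP; rewrite /polP !coefE addr0 oner_eq0.
Qed.

(** Division by the equation, cubic in the outer variable; its leading coefficient
    1 + 'X^3 is not a unit, whence the power on the left. *)
Lemma pseudo_division (G : {poly {poly K}}) : exists k Q a0 a1 a2,
  (polP K)%:P ^+ k * G = Q * curve_poly + quad a0 a1 a2.
Proof.
have szl : (size (- (polM K)%:P : {poly {poly K}})%R < size ((polP K)%:P * 'X ^+ 3)%R)%N.
  rewrite size_polyN mul_polyC size_scale ?polP_neq0 // size_polyXn.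
  exact: leq_ltn_trans (size_polyC_leq1 _) _.
have sz : size curve_poly = 4.
  by rewrite /curve_poly size_polyDl // mul_polyC size_scale ?polP_neq0 // size_polyXn.
have lc : lead_coef curve_poly = (polP K).
  rewrite /curve_poly lead_coefDl // mul_polyC lead_coefZ.
  by rewrite lead_coefXn mulr1.
have /= := rdivp_eq curve_poly G; rewrite lc.
have : (size (rmodp G curve_poly) < 4)%N.
  by rewrite -[X in (_ < X)%N]sz ltn_rmodp -size_poly_eq0 sz.
set R := rmodp _ _; set k := rscalp _ _ => sR E.
exists k, (rdivp G curve_poly), R`_0, R`_1, R`_2.
rewrite -polyC_exp mul_polyC E; congr (_ + _).
apply/polyP => -[|[|[|i]]]; rewrite /quad !coefE /= ?mulr0 ?mulr1 ?addr0 ?add0r //.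
by rewrite nth_default ?mulr0 ?addr0 // -ltnS; apply: leq_trans sR _.
Qed.

Variables (u v : F).
Hypothesis (uv : curve_pair c u v).
Let onc : on_curve u v := cp_eqn uv.

Lemma ev1_eq0 a : ev1 c v a = 0 -> a = 0.
Proof.
by move=> E; apply/eqP/negPn/negP => /ev1_eq0_const/(_ E); apply: (cp_nonconst uv).
Qed.

Lemma quad_eq0 a0 a1 a2 :
  ev c u v (quad a0 a1 a2) = 0 -> [/\ a0 = 0, a1 = 0 & a2 = 0].
Proof.
move=> E; apply: (cubic_norm_eq0 two_neq0 three_neq0); apply: ev1_eq0.
by rewrite -(quad_norm c _ _ _ onc) E mul0r.
Qed.

Lemma ev_kernel G : ev c u v G = 0 ->
  exists k Q, (polP K)%:P ^+ k * G = Q * curve_poly.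
Proof.
have [k [Q [a0 [a1 [a2 E]]]]] := pseudo_division G.
move/(congr1 (ev c u v)): (E); rewrite evD !evM (ev_curve_poly _ onc) mulr0 add0r.
move=> E2 G0; move: E2; rewrite G0 mulr0 => /esym/quad_eq0 [z0 z1 z2].
exists k, Q; rewrite E z0 z1 z2 /quad; ring.
Qed.

(** The power of 1 + 'X^3 in [ev_kernel] does not vanish at a point of the curve, so
    that a polynomial which is zero in F is zero at every point. *)
Lemma ev_kernel_point (L : fieldType) (f : {rmorphism K -> L}) s t G :
  on_curve s t -> 1 + t ^+ 3 != 0 -> ev c u v G = 0 -> ev f s t G = 0.
Proof.
move=> st t0 /ev_kernel [k [Q E]].
move/(congr1 (ev f s t)): E; rewrite !evM evXn (ev_curve_poly _ st) mulr0.
rewrite evC ev1_polP => /eqP; rewrite mulf_eq0 expf_eq0 (negPf t0) andbF /=.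
by move/eqP.
Qed.

Lemma ev_surj z : exists G H, ev c u v H != 0 /\ z = ev c u v G / ev c u v H.
Proof.
move: z; apply: (cp_gen uv); first split.
- move=> k; exists k%:P%:P, 1; rewrite ev_1 oner_neq0 !evE.
  by split=> //; rewrite divr1.
- move=> _ _ [G [H [H0 ->]]] [G' [H' [H'0 ->]]].
  exists (G * H' - G' * H), (H * H'); rewrite evB !evM mulf_neq0 //.
  by split=> //; field; rewrite ?H0 ?H'0.
- move=> _ _ [G [H [H0 ->]]] [G' [H' [H'0 ->]]].
  exists (G * G'), (H * H'); rewrite !evM mulf_neq0 //.
  by split=> //; field; rewrite ?H0 ?H'0.
- move=> _ [G [H [H0 ->]]]; have [G0|G0] := eqVneq (ev c u v G) 0.
    by exists 0, 1; rewrite ev_1 ev_0 oner_neq0 G0 !(mul0r, invr0).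
  by exists H, G; rewrite G0 invf_div.
- by exists 'X, 1; rewrite ev_1 oner_neq0 evX divr1.
by exists 'X%:P, 1; rewrite ev_1 oner_neq0 !evE divr1.
Qed.

Lemma polP_neq0_ev : 1 + v ^+ 3 != 0.
Proof. by have [] := cp_neq two_neq0 uv. Qed.

Lemma ev_normal G : exists a0 a1 a2 k,
  ev c u v G = ev c u v (quad a0 a1 a2) / (1 + v ^+ 3) ^+ k.
Proof.
have [k [Q [a0 [a1 [a2 E]]]]] := pseudo_division G; exists a0, a1, a2, k.
move/(congr1 (ev c u v)): (E).
rewrite evD !evM evXn (ev_curve_poly _ onc) evC ev1_polP mulr0 add0r => <-.
by rewrite mulrAC mulfV ?mul1r // expf_neq0 ?polP_neq0_ev.
Qed.

(** A nonzero element of K[u, v] divides a polynomial in v alone: its norm, up to a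
    power of 1 + v^3. *)
Lemma ev_multiple_base G : ev c u v G != 0 ->
  exists H q, q != 0 /\ ev c u v G * ev c u v H = ev1 c v q.
Proof.
have [a0 [a1 [a2 [k ->]]]] := ev_normal G => G0.
exists (cofactor a0 a1 a2 * (polP K)%:P ^+ k), (cubic_norm a0 a1 a2).
rewrite evM evXn evC ev1_polP -(quad_norm c _ _ _ onc); split.
  apply: contraNneq G0 => /(cubic_norm_eq0 two_neq0 three_neq0) [-> -> ->].
  by rewrite ev_quad !evE !(mul0r, add0r).
by field; apply: expf_neq0; apply: polP_neq0_ev.
Qed.

Lemma normal_form z : exists a0 a1 a2 q,
  q != 0 /\ z = ev c u v (quad a0 a1 a2) / ev1 c v q.
Proof.
have [G [H [H0 ->]]] := ev_surj z.
have [H' [q [q0 Eq]]] := ev_multiple_base H0.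
have [a0 [a1 [a2 [k E]]]] := ev_normal (G * H').
have q1 : ev1 c v q != 0 by apply: contra_neq q0; apply: ev1_eq0.
exists a0, a1, a2, ((polP K) ^+ k * q); split.
  by rewrite mulf_neq0 // expf_neq0 // polP_neq0.
have H'0 : ev c u v H' != 0 by apply: contraNneq q1 => h; rewrite -Eq h mulr0.
rewrite ev1M ev1Xn ev1_polP invfM mulrA -E evM -Eq.
by field; apply/andP.
Qed.

End CubicExtension.

(** * Automorphisms of the curve from automorphisms of its function field *)

Section Transport.
Variables (K : closedFieldType) (F : fieldType) (c : {rmorphism K -> F}).

Lemma place_eq (P Q : place c) : (forall f, local_ring P f <-> local_ring Q f) -> P = Q.
Proof.
case: P Q => [P h1 h2 h3 h4 h5] [Q k1 k2 k3 k4 k5] /= PQ.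
have E : P = Q by apply: funext => f; apply: propext.
by subst Q; f_equal; apply: Prop_irrelevance.
Qed.

HB.instance Definition _ (a : curve_aut c) :=
  GRing.isZmodMorphism.Build F F (pullback a) (pullback_add a).
HB.instance Definition _ (a : curve_aut c) :=
  GRing.isMonoidMorphism.Build F F (pullback a) (pullback_mul a).

(** The action on places is determined by the action on functions. *)
Lemma curve_aut_pullback_inj (a b : curve_aut c) :
  (forall z, pullback a z = pullback b z) -> a = b.
Proof.
move=> ab; have E : pullback a = pullback b by apply: funext.
apply: curve_aut_eq => //; apply: funext => P; apply: place_eq => f.
by rewrite !pullback_local E.
Qed.

Section OfField.
Variables (f g : {rmorphism F -> F}).
Hypotheses (fK : cancel f g) (gK : cancel g f).
Hypotheses (fc : forall k, f (c k) = c k).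

Definition preimage_place (h : {rmorphism F -> F})
    (hc : forall k, h (c k) = c k) (hs : forall z, exists t, h t = z)
    (P : place c) : place c.
Proof.
apply: (@Place K F c (fun z => local_ring P (h z))).
- by move=> k; rewrite hc; apply: place_const.
- by move=> s t Ps Pt; rewrite rmorphB; apply: place_sub.
- by move=> s t Ps Pt; rewrite rmorphM; apply: place_mul.
- by move=> s; rewrite fmorphV; apply: place_val.
have [z Pz] := place_proper P; have [t Et] := hs z.
by exists t; rewrite Et.
Defined.

Let gc k : g (c k) = c k. Proof. by rewrite -[X in g X]fc fK. Qed.

Definition field_curve_aut : curve_aut c.
Proof.
apply: (@CurveAut K F c
  (@preimage_place f fc (fun z => ex_intro _ (g z) (gK z))) f) => //.
- exists (@preimage_place g gc (fun z => ex_intro _ (f z) (fK z))) => P;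
    by apply: place_eq => z /=; rewrite ?fK ?gK.
- by exists g.
- exact: rmorphB.
by split; [apply: rmorph1|apply: rmorphM].
Defined.
End OfField.
End Transport.

Section CoordTransport.
Variables (K : closedFieldType) (F : fieldType) (c : {rmorphism K -> F}).
Hypothesis two_neq0 : (2%:R : K) != 0.
Hypothesis three_neq0 : (3%:R : K) != 0.

Lemma ev_eq0_transfer u v s t G : curve_pair c u v -> curve_pair c s t ->
  ev c u v G = 0 -> ev c s t G = 0.
Proof.
move=> uv st; apply: (ev_kernel_point two_neq0 three_neq0 uv c (cp_eqn st)).
by have [] := cp_neq two_neq0 st.
Qed.

Lemma ev_neq0_transfer u v s t G : curve_pair c u v -> curve_pair c s t ->
  ev c u v G != 0 -> ev c s t G != 0.
Proof. by move=> uv st; apply: contra_neq; apply: ev_eq0_transfer. Qed.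

Section Hom.
Variables (u v s t : F) (uv : curve_pair c u v) (st : curve_pair c s t).

Definition num_of z := projT1 (cid (ev_surj uv z)).
Definition den_of z := projT1 (cid (projT2 (cid (ev_surj uv z)))).

Lemma num_denP z :
  ev c u v (den_of z) != 0 /\ z = ev c u v (num_of z) / ev c u v (den_of z).
Proof. exact: projT2 (cid (projT2 (cid (ev_surj uv z)))). Qed.

(** Substitution of s, t for u, v in an arbitrarily chosen fraction representing z;
    [transportE] shows that the choice is irrelevant. The hypothesis on s, t is an
    argument so that the morphism structure can be attached to this map. *)
Definition transport of curve_pair c s t := fun z => ev c s t (num_of z) / ev c s t (den_of z).

Lemma transportE G H : ev c u v H != 0 ->
  transport st (ev c u v G / ev c u v H) = ev c s t G / ev c s t H.
Proof.
move=> H0; set z := _ / _; have [D0 Ez] := num_denP z.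
apply/eqP; rewrite /transport eqr_div ?(ev_neq0_transfer uv st) //.
rewrite -!evM -subr_eq0 -evB; apply/eqP.
apply: (ev_eq0_transfer uv st); rewrite evB !evM; apply/eqP.
by rewrite subr_eq0 -eqr_div //; apply/eqP; rewrite -Ez.
Qed.

Lemma transport_zmod : zmod_morphism (transport st).
Proof.
move=> y z; have [Dy Ey] := num_denP y; have [Dz Ez] := num_denP z.
have Dy' := ev_neq0_transfer uv st Dy; have Dz' := ev_neq0_transfer uv st Dz.
rewrite {2 3}/transport {1}Ey {1}Ez.
have -> : forall a b d e : F, b != 0 -> e != 0 -> a / b - d / e = (a * e - d * b) / (b * e).
  by move=> a b d e b0 e0; field; apply/andP.
all: rewrite // -!evM -evB transportE ?evM ?mulf_neq0 //.
by rewrite evB !evM; field; apply/andP.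
Qed.

Lemma transport_monoid : monoid_morphism (transport st).
Proof.
split=> [|y z].
  by rewrite -{1}[1](divr1) -(ev_1 c u v) transportE ?ev_1 ?oner_neq0 ?divr1.
have [Dy Ey] := num_denP y; have [Dz Ez] := num_denP z.
rewrite {2 3}/transport {1}Ey {1}Ez mulf_div -!evM transportE ?evM ?mulf_neq0 //.
by rewrite mulf_div.
Qed.

HB.instance Definition _ := GRing.isZmodMorphism.Build F F (transport st) transport_zmod.
HB.instance Definition _ := GRing.isMonoidMorphism.Build F F (transport st) transport_monoid.

Lemma transport_ev G : transport st (ev c u v G) = ev c s t G.
Proof. by have := @transportE G 1; rewrite !ev_1 !divr1; apply; apply: oner_neq0. Qed.

Lemma transport_c k : transport st (c k) = c k.
Proof. by have := transport_ev k%:P%:P; rewrite !evE. Qed.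
End Hom.

Lemma transportK u v s t (uv : curve_pair c u v) (st : curve_pair c s t) :
  cancel (transport uv st) (transport st uv).
Proof.
move=> z; have [D E] := num_denP uv z.
change (transport st uv (ev c s t (num_of uv z) / ev c s t (den_of uv z)) = z).
by rewrite (transportE st uv) ?(ev_neq0_transfer uv st).
Qed.

Lemma coord_aut u v s t : curve_pair c u v -> curve_pair c s t ->
  exists a : curve_aut c, maps_to u v a s t.
Proof.
move=> uv st.
exists (@field_curve_aut _ _ c (transport uv st) (transport st uv)
  (transportK uv st) (transportK st uv) (transport_c uv st)).
by split; have := transport_ev uv st; [move/(_ 'X)|move/(_ 'X%:P)]; rewrite !evE.
Qed.

End CoordTransport.

(** * The derivation of the function field *)

Section Derivations.
Variables (K : closedFieldType) (F : fieldType) (c : {rmorphism K -> F}).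

Record const_derivation (D : F -> F) : Prop := ConstDerivation {
  cd_zmod : zmod_morphism D;
  cd_leibniz : forall s t, D (s * t) = D s * t + s * D t;
  cd_const : forall k, D (c k) = 0 }.

Section Rules.
Variables (D : F -> F) (Dd : const_derivation D).

Lemma cdB s t : D (s - t) = D s - D t. Proof. exact: cd_zmod. Qed.
Lemma cd0 : D 0 = 0. Proof. by have := cdB 0 0; rewrite !subrr. Qed.
Lemma cdN s : D (- s) = - D s. Proof. by rewrite -sub0r cdB cd0 sub0r. Qed.
Lemma cdD s t : D (s + t) = D s + D t.
Proof. by rewrite -[t in LHS]opprK cdB cdN opprK. Qed.
Lemma cd1 : D 1 = 0. Proof. by rewrite -(rmorph1 c) (cd_const Dd). Qed.
Lemma cdV s : D s^-1 = - D s / s ^+ 2.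
Proof.
have [->|s0] := eqVneq s 0; first by rewrite invr0 cd0 oppr0 mul0r.
have : D (s * s^-1) = 0 by rewrite mulfV // cd1.
rewrite (cd_leibniz Dd) => /eqP; rewrite addr_eq0 => /eqP E.
apply: (mulfI s0); rewrite -[LHS]opprK -E; field; exact: s0.
Qed.
Lemma cdX3 s : D (s ^+ 3) = 3%:R * s ^+ 2 * D s.
Proof. by rewrite !exprS expr0 !(cd_leibniz Dd) cd1; ring. Qed.
End Rules.

Hypothesis two_neq0 : (2%:R : K) != 0.
Hypothesis three_neq0 : (3%:R : K) != 0.

(** A derivation over K is determined by its value at v, since u is separable
    algebraic over K(v): derivations form a space of dimension one over F. *)
Lemma cd_eq0 u v D : curve_pair c u v -> const_derivation D -> D v = 0 ->
  forall z, D z = 0.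
Proof.
move=> uv Dd Dv; have [u0 v0] := cp_neq two_neq0 uv; have [_ eqn gen] := uv.
have un0 : u != 0.
  apply/eqP => z; apply: (cp_nonconst uv); apply: (@const_root _ _ _ _ 3) => //.
  exists 1; apply: (addrI 1); rewrite rmorph1 -[RHS]/(2%:R) -eqn z; ring.
have Du : D u = 0.
  have := congr1 D (etrans eqn (esym (rmorph_nat c 2))).
  rewrite (cd_leibniz Dd) !(cdD Dd) !(cdX3 Dd) Dv (cd_const Dd).
  rewrite !(cd1 Dd) !(mulr0, addr0, add0r) => /eqP.
  rewrite !mulf_eq0 (negPf v0) (negPf un0) (negPf (three_neq0F c three_neq0)).
  by rewrite orbF => /eqP.
apply: gen => //; split => [k|s t Ds Dt|s t Ds Dt|s Ds].
- exact: (cd_const Dd).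
- by rewrite (cdB Dd) Ds Dt subrr.
- by rewrite (cd_leibniz Dd) Ds Dt mul0r mulr0 addr0.
by rewrite (cdV Dd) Ds oppr0 mul0r.
Qed.

Section CurveDerivation.
Variables (u v : F) (uv : curve_pair c u v).
Let onc : on_curve u v := cp_eqn uv.
(* This choice makes D the vector field dual to a differential without zeros or
   poles at finite distance, and D preserves K[u, v]. *)
Let du := v ^+ 2 * (1 + u ^+ 3).
Let dv := - u ^+ 2 * (1 + v ^+ 3).

(** The value of D on G(u, v) by the chain rule; swapXY turns the derivative in the
    outer variable into the one in the inner variable. *)
Definition dpoly (G : {poly {poly K}}) : F :=
  ev c u v (swapXY (swapXY G)^`()) * dv + ev c u v G^`() * du.

Lemma dpolyB G H : dpoly (G - H) = dpoly G - dpoly H.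
Proof.
have swB : {morph @swapXY K : a b / a - b} by exact: rmorphB.
have dB (R : nzRingType) : {morph @deriv R : a b / a - b} by exact: raddfB.
rewrite /dpoly swB 2!dB swB 2!evB.
by rewrite mulrBl mulrBl opprD addrACA.
Qed.

Lemma dpolyM G H :
  dpoly (G * H) = dpoly G * ev c u v H + ev c u v G * dpoly H.
Proof.
rewrite /dpoly (rmorphM swapXY) !derivM (rmorphD swapXY) !(rmorphM swapXY) /=.
by rewrite !swapXYK !evD !evM; ring.
Qed.

Lemma dpolyC k : dpoly k%:P%:P = 0.
Proof.
by rewrite /dpoly swapXY_polyC map_polyC /= !derivC rmorph0 /= ev_0 !mul0r addr0.
Qed.

Lemma dpolyX : dpoly 'X = du.
Proof. by rewrite /dpoly swapXY_X derivX derivC rmorph0 ev_0 ev_1; ring. Qed.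

Lemma dpolyY : dpoly 'X%:P = dv.
Proof. by rewrite /dpoly swapXY_Y derivX derivC rmorph1 ev_0 ev_1; ring. Qed.

Lemma dpoly1 : dpoly 1 = 0.
Proof. exact: (dpolyC 1). Qed.

Lemma dpolyX3 G : dpoly (G ^+ 3) = 3%:R * ev c u v G ^+ 2 * dpoly G.
Proof. by rewrite !exprS expr0 !dpolyM !evM ev_1 dpoly1; ring. Qed.

Lemma dpoly_curve : dpoly (curve_poly K) = 0.
Proof.
rewrite /curve_poly /polP /polM polyCD polyCB !polyC_exp polyC1.
set X : {poly {poly K}} := 'X; set Y : {poly {poly K}} := 'X%:P.
have dD G H : dpoly (G + H) = dpoly G + dpoly H.
  have d0 : dpoly 0 = 0 by have := dpolyB 0 0; rewrite !subrr.
  by have := dpolyB G (0 - H); rewrite [dpoly (0 - H)]dpolyB d0 !sub0r !opprK.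
rewrite dpolyB dpolyM dpolyB dD !dpolyX3 dpoly1 dpolyX dpolyY.
rewrite !evME !evE.
by rewrite /du /dv; ring.
Qed.

Lemma dpoly_eq0 G : ev c u v G = 0 -> dpoly G = 0.
Proof.
move=> G0; have [k [Q E]] := ev_kernel two_neq0 three_neq0 uv G0.
move/(congr1 dpoly): E; rewrite !dpolyM dpoly_curve G0 (ev_curve_poly _ onc) !mulr0.
rewrite !add0r evXn evC ev1_polP => /eqP.
by rewrite mulf_eq0 expf_eq0 (negPf (polP_neq0_ev two_neq0 uv)) andbF => /eqP.
Qed.

Definition curve_derivation z : F :=
  (dpoly (num_of uv z) * ev c u v (den_of uv z)
   - ev c u v (num_of uv z) * dpoly (den_of uv z)) / ev c u v (den_of uv z) ^+ 2.

Lemma curve_derivationE G H : ev c u v H != 0 ->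
  curve_derivation (ev c u v G / ev c u v H) =
  (dpoly G * ev c u v H - ev c u v G * dpoly H) / ev c u v H ^+ 2.
Proof.
move=> H0; set z := _ / _; have [] := num_denP uv z.
rewrite /curve_derivation; move: (num_of _ _) (den_of _ _) => N M M0 E.
have /dpoly_eq0 : ev c u v (G * M - N * H) = 0.
  by rewrite evB !evM; apply/eqP; rewrite subr_eq0 -eqr_div // -E.
rewrite dpolyB !dpolyM => E2.
have GE : ev c u v G = ev c u v N / ev c u v M * ev c u v H.
  by rewrite -E /z divfK.
have dGE : dpoly G = (dpoly N * ev c u v H + ev c u v N * dpoly H
   - ev c u v G * dpoly M) / ev c u v M.
  apply: (mulIf M0); rewrite divfK //; apply/eqP; rewrite -subr_eq0 -[X in _ == X]E2.
  by apply/eqP; ring.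
by rewrite dGE GE; field; apply/andP.
Qed.

Lemma curve_derivation_ev G : curve_derivation (ev c u v G) = dpoly G.
Proof.
have := @curve_derivationE G 1; rewrite ev_1 divr1 => -> //; last exact: oner_neq0.
by rewrite dpoly1 expr1n mulr0 subr0 divr1 mulr1.
Qed.

Lemma curve_derivationP : const_derivation curve_derivation.
Proof.
split=> [y z|y z|k]; last first.
- by have := curve_derivation_ev k%:P%:P; rewrite dpolyC !evE.
all: have [Dy ->] := num_denP uv y; have [Dz ->] := num_denP uv z.
  rewrite mulf_div -!evM !curve_derivationE ?evM ?mulf_neq0 //.
  by rewrite !dpolyM; field; apply/andP.
have -> : forall a b d e : F, b != 0 -> e != 0 -> a / b - d / e = (a * e - d * b) / (b * e).
  by move=> a b d e b0 e0; field; apply/andP.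
all: rewrite // -!evM -evB !curve_derivationE ?evM ?mulf_neq0 //.
by rewrite dpolyB !dpolyM !evB !evM; field; apply/andP.
Qed.

Lemma curve_derivation_u : curve_derivation u = v ^+ 2 * (1 + u ^+ 3).
Proof. by have := curve_derivation_ev 'X; rewrite evX dpolyX. Qed.
Lemma curve_derivation_v : curve_derivation v = - u ^+ 2 * (1 + v ^+ 3).
Proof. by have := curve_derivation_ev 'X%:P; rewrite !evE dpolyY. Qed.

End CurveDerivation.
End Derivations.

(** * Local rings of the affine points *)

Section Points.
Variables (K : closedFieldType) (F : fieldType) (c : {rmorphism K -> F}).
Hypothesis two_neq0 : (2%:R : K) != 0.
Hypothesis three_neq0 : (3%:R : K) != 0.

Lemma on_curve_neq0 (be al : K) : on_curve be al ->
  1 + be ^+ 3 != 0 /\ 1 + al ^+ 3 != 0.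
Proof.
by move=> h; apply/andP; move: two_neq0; rewrite -h mulf_eq0 negb_or.
Qed.

Lemma on_curve_sym (L : fieldType) (s t : L) : on_curve s t -> on_curve t s.
Proof. by rewrite /on_curve mulrC. Qed.

(* The first coordinate is the value of u, the second that of v. *)
Definition at_point (be al : K) : {poly {poly K}} -> K := ev idfun be al.

Lemma at_pointE be al G : at_point be al G = G.[be%:P].[al].
Proof.
rewrite /at_point /ev (@map_poly_id _ (map_poly idfun)) // => p _.
exact: (@map_poly_id _ idfun).
Qed.

Definition local_at (u v : F) (be al : K) (z : F) : Prop :=
  exists G H, at_point be al H != 0 /\ z = ev c u v G / ev c u v H.

Lemma local_at_swap u v be al z : local_at u v be al z -> local_at v u al be z.
Proof.
move=> [G [H [H0 ->]]]; exists (swapXY G), (swapXY H).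
by rewrite /at_point !ev_swap.
Qed.

Section Local.
Variables (u v : F) (uv : curve_pair c u v).
Variables (be al : K) (pt : on_curve be al).
Let val G := at_point be al G.
Let O z := local_at u v be al z.
Let onc : on_curve u v := cp_eqn uv.
Let al0 : 1 + al ^+ 3 != 0. Proof. by have [] := on_curve_neq0 pt. Qed.

Lemma at_point_eq0 G : ev c u v G = 0 -> val G = 0.
Proof. exact: (ev_kernel_point two_neq0 three_neq0 uv idfun pt al0). Qed.

Lemma at_point_neq0 G : val G != 0 -> ev c u v G != 0.
Proof. by apply: contra_neq; apply: at_point_eq0. Qed.

(** How membership in the local ring is used: a relation f G = G' on the curve can be
    evaluated at the point as soon as f is regular there. *)
Lemma local_vanish f G G' :
  O f -> f * ev c u v G = ev c u v G' -> val G = 0 -> val G' = 0.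
Proof.
move=> [A [B [B0 ->]]] E G0; have B1 := at_point_neq0 B0.
have /at_point_eq0 : ev c u v (A * G - B * G') = 0.
  by rewrite evB !evM -E; field.
rewrite /val /at_point in B0 G0 *.
rewrite evB !evM G0 mulr0 sub0r => /eqP.
by rewrite oppr_eq0 mulf_eq0 (negPf B0) => /eqP.
Qed.

Lemma local_ev G : O (ev c u v G).
Proof. by exists G, 1; rewrite /at_point !ev_1 divr1 oner_neq0. Qed.

Lemma local_const k : O (c k).
Proof. by have := local_ev k%:P%:P; rewrite !evE. Qed.

Lemma local_sub y z : O y -> O z -> O (y - z).
Proof.
move=> [G [H [H0 ->]]] [G' [H' [H'0 ->]]].
exists (G * H' - G' * H), (H * H'); rewrite /at_point evB !evM mulf_neq0 //.
by split=> //; field; rewrite ?at_point_neq0.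
Qed.

Lemma local_mul y z : O y -> O z -> O (y * z).
Proof.
move=> [G [H [H0 ->]]] [G' [H' [H'0 ->]]].
by exists (G * G'), (H * H'); rewrite /at_point !evM mulf_neq0 // mulf_div.
Qed.

Lemma local_add y z : O y -> O z -> O (y + z).
Proof.
move=> Oy Oz; rewrite -[z]opprK -[- z]sub0r; do 2![apply: local_sub => //].
by rewrite -(ev_0 c u v); apply: local_ev.
Qed.

Lemma local_inv G : val G != 0 -> O (ev c u v G)^-1.
Proof. by move=> G0; exists 1, G; rewrite ev_1 div1r. Qed.

Let t := v - c al.

Lemma t_ev : t = ev c u v ('X - al%:P)%:P.
Proof. by rewrite evC ev1B !evE. Qed.

Lemma t_neq0 : t != 0.
Proof.
rewrite subr_eq0; apply/eqP => E; apply: (cp_nonconst uv).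
by exists al.
Qed.

Lemma tV_nonlocal : ~ O t^-1.
Proof.
move=> Ot; have := @local_vanish t^-1 ('X - al%:P)%:P 1 Ot.
rewrite -t_ev ev_1 mulVf ?t_neq0 // /val /at_point evC ev1B !evE subrr => /(_ erefl erefl).
by move/eqP; rewrite oner_eq0.
Qed.

Hypothesis be0 : be != 0.

(** v - al is a uniformizer when be is not 0: dividing the difference of the equations
    for (u, v) and (be, al) by u^2 + u be + be^2, whose value 3 be^2 is not 0,
    expresses u - be as a multiple of v - al. *)
Lemma u_sub_be : exists2 w, O w & u - c be = t * w.
Proof.
pose G : {poly {poly K}} := - (2%:R * ('X ^+ 2 + 'X * al%:P + al%:P ^+ 2))%:P.
pose H : {poly {poly K}} := (1 + 'X ^+ 3)%:P * (1 + al%:P ^+ 3)%:P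
   * ('X ^+ 2 + 'X * be%:P%:P + be%:P%:P ^+ 2).
have H0 : val H != 0.
  rewrite /val /at_point /H !(evE, evME) /= !mulf_neq0 //.
  have -> : be ^+ 2 + be * be + be ^+ 2 = 3%:R * be ^+ 2 by ring.
  by rewrite mulf_neq0 // expf_neq0.
exists (ev c u v G / ev c u v H); first by exists G, H.
have := at_point_neq0 H0.
rewrite /G /H /t !(evE, evME) /= => H1.
apply: (mulIf H1); rewrite mulrA divfK //.
have := on_curve_cube onc; have := on_curve_cube pt.
move=> /(congr1 c); rewrite rmorphM rmorphB rmorphD !rmorphXn rmorph1.
move: (c be) (c al) => b a E1 E2.
transitivity ((1 + a ^+ 3) * ((1 + v ^+ 3) * u ^+ 3) - (1 + v ^+ 3) * ((1 + a ^+ 3) * b ^+ 3)).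
  by ring.
by rewrite E1 E2; ring.
Qed.

Lemma local_factor G : val G = 0 -> exists2 w, O w & ev c u v G = t * w.
Proof.
move=> G0; pose a := G.[be%:P].
have /factor_theorem [G1 EG] : root (G - a%:P) be%:P.
  by rewrite /root !hornerE subrr.
have Ea : a.[al] = 0.
  by rewrite -[RHS]G0 /val at_pointE.
have [b Eb] := root_factor Ea; have [w Ow Ew] := u_sub_be.
exists (ev c u v b%:P + w * ev c u v G1).
  by apply: local_add; [|apply: local_mul]; rewrite //; apply: local_ev.
have -> : G = a%:P + G1 * ('X - be%:P%:P) by rewrite -EG; ring.
rewrite Eb evD !evM evB !evC ev1M ev1B !evE Ew /t; ring.
Qed.

Definition local_unit w := [/\ O w, O w^-1 & w != 0].

Lemma local_unitM y z : local_unit y -> local_unit z -> local_unit (y * z).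
Proof.
by move=> [? ? ?] [? ? ?]; split; rewrite ?invfM ?mulf_neq0 //; apply: local_mul.
Qed.

Lemma local_unitV y : local_unit y -> local_unit y^-1.
Proof. by move=> [? ? ?]; split; rewrite ?invrK ?invr_neq0. Qed.

Lemma local_unit_ev G : val G != 0 -> local_unit (ev c u v G).
Proof.
by move=> G0; split; [exact: local_ev|exact: local_inv|exact: at_point_neq0].
Qed.

Lemma local_dichotomy f : O f -> local_unit f \/ exists2 g, O g & f = t * g.
Proof.
move=> [G [H [H0 ->]]]; have UH := local_unit_ev H0.
have [/local_factor [w Ow ->]|G0] := eqVneq (val G) 0.
  right; exists (w / ev c u v H); last by rewrite mulrA.
  by apply: local_mul => //; case: UH.
by left; apply: local_unitM (local_unitV UH); apply: local_unit_ev.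
Qed.

(** Divisors of a power of the uniformizer are powers of it, up to units. *)
Lemma local_order_div e f f' w : O f -> O f' -> local_unit w ->
  f * f' = t ^+ e * w -> exists i w', local_unit w' /\ f = t ^+ i * w'.
Proof.
elim: e f => [|e IH] f Of Of' Uw E; have [Uf|[g Og Eg]] := local_dichotomy Of.
- by exists 0%N, f; rewrite mul1r.
- case: tV_nonlocal; have [Ow Ow' w0] := Uw.
  have -> : t^-1 = g * f' * w^-1.
    have t0 := t_neq0; apply: (mulfI t0); rewrite mulfV //.
    by rewrite !mulrA -Eg E mul1r mulfV.
  by do 2!apply: local_mul => //.
- by exists 0%N, f; rewrite mul1r.
have [|i [w' [Uw' Ew']]] := IH g Og Of' Uw.
  by apply: (mulfI t_neq0); rewrite mulrA -Eg E exprS mulrA.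
by exists i.+1, w'; split; rewrite // Eg Ew' exprS mulrA.
Qed.

(** Every numerator divides a polynomial in v, hence a power of v - al times a unit;
    this bounds its order of vanishing. *)
Lemma local_order z : z != 0 -> exists i w j, local_unit w /\ z = t ^+ i * w / t ^+ j.
Proof.
have ev_order G : ev c u v G != 0 -> exists i w, local_unit w /\ ev c u v G = t ^+ i * w.
  move=> /(ev_multiple_base two_neq0 three_neq0 uv) [G' [q [q0 Eq]]].
  have [e [q1 Nq1 Eq1]] := multiplicity_XsubC q al; rewrite q0 /= in Nq1.
  apply: (@local_order_div e _ (ev c u v G') (ev c u v q1%:P));
    [exact: local_ev|exact: local_ev| |].
    by apply: local_unit_ev; rewrite /val /at_point evC ev1_root.
  by rewrite Eq Eq1 evC ev1M ev1Xn ev1B !evE mulrC.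
have [G [H [H0 ->]]] := ev_surj uv z.
rewrite mulf_eq0 negb_or => /andP [/ev_order [i [w [Uw ->]]] _].
have [j [w' [Uw' ->]]] := ev_order _ H0.
exists i, (w / w'), j; split; first exact: local_unitM (local_unitV Uw').
by have [_ _ w0] := Uw'; field; rewrite expf_neq0 ?t_neq0.
Qed.

Lemma local_total z : O z \/ O z^-1.
Proof.
have [->|/local_order [i [w [j [[Ow Ow' w0] ->]]]]] := eqVneq z 0.
  by left; rewrite -(rmorph0 c); apply: local_const.
have OX n : O (t ^+ n) by rewrite t_ev -evXn; apply: local_ev.
have [ij|/ltnW ij] := leqP j i; [left|right].
  rewrite mulrAC -exprB ?unitfE ?t_neq0 //; exact: local_mul.
rewrite !invfM invrK mulrAC mulrC [_ * t ^+ j]mulrC -exprB ?unitfE ?t_neq0 //.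
exact: local_mul.
Qed.
End Local.

(** When be = 0 the roles of u and v are exchanged; be and al are not both 0. *)
Lemma local_total_all u v be al z : curve_pair c u v -> on_curve be al ->
  local_at u v be al z \/ local_at u v be al z^-1.
Proof.
move=> uv pt; have [be0|be0] := eqVneq be 0; last exact: local_total.
have [|h|h] := @local_total v u (cp_swap two_neq0 uv) al be (on_curve_sym pt) _ z.
- apply: contraTneq isT => al0; move: pt; rewrite /on_curve be0 al0.
  rewrite expr0n !addr0 mulr1 => /eqP; rewrite -subr_eq0 -oppr_eq0 opprB.
  by rewrite -[X in X - _]/(1 + 1) addrK oner_eq0.
- by left; apply: local_at_swap.
by right; apply: local_at_swap.
Qed.

Lemma point_place u v be al : curve_pair c u v -> on_curve be al ->
  exists P : place c, forall z, local_ring P z <-> local_at u v be al z.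
Proof.
move=> uv pt.
exists (@Place K F c (local_at u v be al)
  (fun k => local_const u v be al k) (fun y z => local_sub uv pt (y := y) (z := z))
  (fun y z => @local_mul u v be al y z) (fun z => local_total_all z uv pt)
  (ex_intro (fun f => ~ local_at u v be al f) _ (tV_nonlocal uv pt))).
by [].
Qed.

(** D maps K[u, v] to itself, hence its localizations too. *)
Lemma derivation_local u v (uv : curve_pair c u v) be al z : on_curve be al ->
  local_at u v be al z -> local_at u v be al (curve_derivation uv z).
Proof.
move=> pt [G [H [H0 ->]]]; rewrite curve_derivationE ?(at_point_neq0 uv pt) //.
apply: local_mul; last by rewrite -evXn; apply: local_inv; rewrite /at_point evXn expf_neq0.
have Od A : local_at u v be al (dpoly c u v A).
  have -> : dpoly c u v A = ev c u v (swapXY (swapXY A)^`() * (- 'X ^+ 2 * (1 + 'X ^+ 3)%:P)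
     + A^`() * ('X%:P ^+ 2 * (1 + 'X ^+ 3))) by rewrite !(evE, evME).
  exact: local_ev.
by apply: (local_sub uv pt); apply: local_mul => //; apply: local_ev.
Qed.

End Points.

(** * Regular differentials *)

Section Regular.
Variables (K : closedFieldType) (F : fieldType) (c : {rmorphism K -> F}).
Hypothesis two_neq0 : (2%:R : K) != 0.
Hypothesis three_neq0 : (3%:R : K) != 0.

(** k stands for the differential that takes the value k on D. It is regular at a
    place P when it takes values in the local ring of P on all derivations that
    preserve this ring, and those are the multiples h D. *)
Definition regular (D : F -> F) (k : F) : Prop :=
  forall (P : place c) h,
    (forall f, local_ring P f -> local_ring P (h * D f)) -> local_ring P (h * k).

Section PlaceClosure.
Variable P : place c.
Local Notation R := (local_ring P).
Lemma plC k : R (c k). Proof. exact: place_const. Qed.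
Lemma plB s t : R s -> R t -> R (s - t). Proof. exact: place_sub. Qed.
Lemma plM s t : R s -> R t -> R (s * t). Proof. exact: place_mul. Qed.
Lemma pl1 : R 1. Proof. by rewrite -(rmorph1 c); apply: plC. Qed.
Lemma plN s : R s -> R (- s).
Proof. by move=> Rs; rewrite -sub0r -(rmorph0 c); apply: plB => //; apply: plC. Qed.
Lemma plD s t : R s -> R t -> R (s + t).
Proof. by move=> Rs Rt; rewrite -[t]opprK; apply: plB => //; apply: plN. Qed.
Lemma plX s i : R s -> R (s ^+ i).
Proof.
move=> Rs; elim: i => [|i IH]; first by rewrite expr0; apply: pl1.
by rewrite exprS; apply: plM.
Qed.
Lemma pl_half : R (2%:R)^-1.
Proof. by rewrite -(rmorph_nat c) -fmorphV; apply: plC. Qed.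
End PlaceClosure.

Lemma regularD D k l : regular D k -> regular D l -> regular D (k + l).
Proof. by move=> rk rl P h H; rewrite mulrDr; apply: plD; [apply: rk|apply: rl]. Qed.

Lemma regularZ D a k : regular D k -> regular D (c a * k).
Proof. by move=> rk P h H; rewrite mulrCA; apply: plM; [apply: plC|apply: rk]. Qed.

(** Conjugating D by the automorphism gives another derivation, hence a multiple of D;
    the definition of regularity is transported with it. *)
Lemma regular_pullback u v (uv : curve_pair c u v) (D : F -> F) (a : curve_aut c) :
  const_derivation c D -> D v != 0 ->
  exists s, [/\ s != 0, forall z, pullback a (D z) = s * D (pullback a z) &
    forall k, regular D k -> regular D (pullback a k / s)].
Proof.
move=> Dd Dv; pose b := curve_aut_inv a.
have [aK Ka] := bij_invK (pullback_bij a).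
have bK : cancel (pullback b) (pullback a) by exact: Ka.
have Kb : cancel (pullback a) (pullback b) by exact: aK.
clearbody b.
pose s := pullback a (D (pullback b v)) / D v.
have sE z : pullback a (D z) = s * D (pullback a z).
  apply/eqP; rewrite -subr_eq0 -[z in D z]Kb; apply/eqP; move: (pullback a z).
  apply: (cd_eq0 two_neq0 three_neq0 uv); last by rewrite /s divfK ?subrr.
  split=> [y t|y t|k].
  - by rewrite !(rmorphB, cdB Dd) /=; ring.
  - rewrite (rmorphM (pullback b)) !(cd_leibniz Dd) (rmorphD (pullback a)).
    by rewrite !(rmorphM (pullback a)) /= !bK; ring.
  - by rewrite (pullback_const b) (cd_const Dd) rmorph0 mulr0 subrr.
have s0 : s != 0.
  apply: contraNneq Dv => z; have := sE v; rewrite z mul0r => /eqP.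
  by rewrite fmorph_eq0 => /eqP ->.
exists s; split=> // k rk P h H.
have : local_ring (point_map a P) (pullback b (h / s) * k).
  apply: rk => f /pullback_local Pf; apply/pullback_local.
  by rewrite (rmorphM (pullback a)) /= bK sE mulrA divfK //; apply: H.
by move/pullback_local; rewrite (rmorphM (pullback a)) /= bK mulrAC -mulrA.
Qed.

Section Basis.
Variables (u v : F) (D : F -> F).
Hypotheses (onc : on_curve u v) (Dd : const_derivation c D).
Hypotheses (Du : D u = v ^+ 2 * (1 + u ^+ 3)) (Dv : D v = - u ^+ 2 * (1 + v ^+ 3)).
Variables (P : place c) (h : F).
Hypothesis hD : forall f, local_ring P f -> local_ring P (h * D f).
Local Notation R := (local_ring P).

(** From h D u and h D v one recovers h v^2 and h u^2, because 1 + u^3 and 1 + v^3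
    are inverse to each other up to the factor 2; then h itself, because
    1 = u^3 + v^3 + u^3 v^3. *)
Lemma basis_finite : R u -> R v ->
  [/\ R h, R (h * u), R (h * v) & R (h * (u * v))].
Proof.
move=> Ru Rv; have two0 := two_neq0F c two_neq0.
have Rhu : R (h * u ^+ 2).
  have -> : h * u ^+ 2 = - (h * D v) * (1 + u ^+ 3) * 2%:R^-1.
    by apply: (mulIf two0); rewrite divfK // -{1}onc Dv; ring.
  by do !apply: plM; [apply: plN; apply: hD|apply: plD; [apply: pl1|apply: plX]|apply: pl_half].
have Rhv : R (h * v ^+ 2).
  have -> : h * v ^+ 2 = (h * D u) * (1 + v ^+ 3) * 2%:R^-1.
    by apply: (mulIf two0); rewrite divfK // -{1}onc Du; ring.
  apply: plM; last exact: pl_half.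
  by apply: plM; [apply: hD|apply: plD; [apply: pl1|apply: plX]].
have Rh : R h.
  have -> : h = h * u ^+ 2 * u + h * v ^+ 2 * v + h * u ^+ 2 * u * v ^+ 3.
    transitivity (h * ((1 + u ^+ 3) * (1 + v ^+ 3) - 1)); last by ring.
    by rewrite onc; ring.
  by apply: plD; [apply: plD|]; do ?apply: plM => //; apply: plX.
by split=> //; do ?apply: plM.
Qed.

(** Where u has a pole, w = 1/u and v are finite and satisfy (1 + w^3) (1 - v^3) = 2;
    the argument at finite distance applies to w, -v and h u instead of u, v and h. *)
Lemma basis_pole : ~ R u ->
  [/\ R h, R (h * u), R (h * v) & R (h * (u * v))].
Proof.
move=> NRu; have two0 := two_neq0F c two_neq0.
have u0 : u != 0 by apply/eqP => E0; apply: NRu; rewrite E0 -(rmorph0 c); apply: plC.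
have := NRu; have [//|] := place_val P u.
set w := u^-1 => Rw _.
have uw : u * w = 1 by rewrite mulfV.
have wv : (1 + w ^+ 3) * (1 - v ^+ 3) = 2%:R.
  rewrite -(on_curve_cube onc) -onc.
  transitivity ((u ^+ 3 + (u * w) ^+ 3) * (1 + v ^+ 3)); first by ring.
  by rewrite uw; ring.
have Rv : R v.
  have [//|Rv'] := place_val P v; apply: contrapT => NRv.
  have v0 : v != 0 by apply/eqP => E0; apply: NRv; rewrite E0 -(rmorph0 c); apply: plC.
  set w' := v^-1 in Rv'.
  have vw : v * w' = 1 by rewrite mulfV.
  have E : 1 = w ^+ 3 * w' ^+ 3 - w ^+ 3 - w' ^+ 3.
    have : (w * w') ^+ 3 * ((1 + u ^+ 3) * (1 + v ^+ 3) - 2%:R) = 0.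
      by rewrite onc subrr mulr0.
    move=> E; rewrite -[LHS]subr0 -E.
    transitivity (1 - (w ^+ 3 + (u * w) ^+ 3) * (w' ^+ 3 + (v * w') ^+ 3) + 2%:R * (w * w') ^+ 3).
      by ring.
    by rewrite uw vw; ring.
  have [Rq|Rq] := place_val P (u * w').
    apply: NRu; have -> : u = w ^+ 2 * w' ^+ 3 - w ^+ 2 - w' ^+ 2 * (u * w').
      rewrite -{1}[u]mulr1 E.
      transitivity ((u * w) * w ^+ 2 * w' ^+ 3 - (u * w) * w ^+ 2 - w' ^+ 2 * (u * w')).
        by ring.
      by rewrite uw; ring.
    apply: plB; last by apply: plM => //; apply: plX.
    by apply: plB; [apply: plM|]; apply: plX.
  have Rq' : R (v * w) by move: Rq; rewrite invfM invrK mulrC.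
  apply: NRv; have -> : v = w' ^+ 2 * w ^+ 3 - w' ^+ 2 - w ^+ 2 * (v * w).
    rewrite -{1}[v]mulr1 E.
    transitivity ((v * w') * w' ^+ 2 * w ^+ 3 - (v * w') * w' ^+ 2 - w ^+ 2 * (v * w)).
      by ring.
    by rewrite vw; ring.
  apply: plB; last by apply: plM => //; apply: plX.
  by apply: plB; [apply: plM|]; apply: plX.
pose h' := h * u.
have Dw : D w = - v ^+ 2 * u * (1 + w ^+ 3).
  by rewrite /w (cdV Dd) Du; field.
have Rw3 : R (1 + w ^+ 3) by apply: plD; [apply: pl1|apply: plX].
have Rv3 : R (1 - v ^+ 3) by apply: plB; [apply: pl1|apply: plX].
have R1 : R (h' * w ^+ 2).
  have -> : h' * w ^+ 2 = - (h * D v) * (1 + w ^+ 3) * 2%:R^-1.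
    apply: (mulIf two0); rewrite divfK // Dv /h' -{1}wv -(on_curve_cube onc).
    have -> : h * u * w ^+ 2 * ((1 + w ^+ 3) * ((1 + v ^+ 3) * u ^+ 3)) =
      h * (u * w) ^+ 2 * u ^+ 2 * (1 + w ^+ 3) * (1 + v ^+ 3) by ring.
    by rewrite uw; ring.
  by do !apply: plM => //; [apply: plN; apply: hD|apply: pl_half].
have R2 : R (h' * v ^+ 2).
  have -> : h' * v ^+ 2 = - (h * D w) * (1 - v ^+ 3) * 2%:R^-1.
    by apply: (mulIf two0); rewrite divfK // Dw /h' -{1}wv; ring.
  by do !apply: plM => //; [apply: plN; apply: hD|apply: pl_half].
have Rh' : R h'.
  have -> : h' = h' * w ^+ 2 * w - h' * v ^+ 2 * v - h' * w ^+ 2 * w * v ^+ 3.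
    transitivity (h' * ((1 + w ^+ 3) * (1 - v ^+ 3) - 1)); last by ring.
    by rewrite wv; ring.
  by apply: plB; [apply: plB|]; do ?apply: plM => //; apply: plX.
have Rh : R h by rewrite -[h]mulr1 -uw mulrA; apply: plM.
by split=> //; rewrite ?mulrA; apply: plM.
Qed.
End Basis.

Section CurveRegular.
Variables (u v : F) (uv : curve_pair c u v).
Let onc : on_curve u v := cp_eqn uv.
Let D := curve_derivation uv.

(** Where v has a pole, exchange u and v; this replaces D by its opposite. *)
Lemma basis_regular :
  [/\ regular D 1, regular D u, regular D v & regular D (u * v)].
Proof.
have Dd : const_derivation c D := curve_derivationP two_neq0 three_neq0 uv.
have Du : D u = _ := curve_derivation_u two_neq0 three_neq0 uv.
have Dv : D v = _ := curve_derivation_v two_neq0 three_neq0 uv.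
suff H (P : place c) h : (forall f, local_ring P f -> local_ring P (h * D f)) ->
    [/\ local_ring P h, local_ring P (h * u), local_ring P (h * v)
      & local_ring P (h * (u * v))].
  by split=> P h /H [? ? ? ?]; rewrite ?mulr1.
move=> hD; have [Ru|NRu] := EM (local_ring P u); last exact: (basis_pole onc Dd Du Dv hD NRu).
have [Rv|NRv] := EM (local_ring P v); first exact: (basis_finite onc Du Dv hD Ru Rv).
have [] := @basis_pole v u (fun z => - D z) (on_curve_sym onc) _ _ _ P h _ NRv.
- split=> [s t|s t|k]; first by rewrite (cdB Dd); ring.
  + by rewrite (cd_leibniz Dd); ring.
  + by rewrite (cd_const Dd) oppr0.
- by rewrite Dv; ring.
- by rewrite Du; ring.
- by move=> f Pf; rewrite mulrN; apply: plN; apply: hD.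
by rewrite [v * u]mulrC.
Qed.

Lemma regular_local be al k : on_curve be al -> regular D k -> local_at c u v be al k.
Proof.
move=> pt rk; have [P HP] := point_place two_neq0 three_neq0 uv pt.
have := rk P 1; rewrite mul1r HP; apply => f; rewrite !HP mul1r.
exact: derivation_local.
Qed.
End CurveRegular.
End Regular.

(** * Automorphisms that move the points at infinity *)

Section RegularBound.
Variables (K : closedFieldType) (F : fieldType) (c : {rmorphism K -> F}).
Hypothesis two_neq0 : (2%:R : K) != 0.
Hypothesis three_neq0 : (3%:R : K) != 0.

Lemma pullback_ev1 (a : curve_aut c) z p :
  pullback a (ev1 c z p) = ev1 c (pullback a z) p.
Proof.
rewrite /ev1 -horner_map -map_poly_comp; congr horner.
by apply: eq_map_poly => k; apply: pullback_const.
Qed.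

Lemma exists_root (q : {poly K}) : size q != 1 -> exists al, q.[al] = 0.
Proof. by move/closed_rootP => [al /rootP ?]; exists al. Qed.

Lemma cube_root (k : K) : exists b, b ^+ 3 = k.
Proof.
have [|b] := @exists_root ('X^3 - k%:P); first by rewrite size_XnsubC.
by rewrite !hornerE => /eqP; rewrite subr_eq0 => /eqP; exists b.
Qed.

Lemma cube_root_of_unity : exists w : K, [/\ w ^+ 3 = 1, w != 1 & 1 + w + w ^+ 2 = 0].
Proof.
have [|w] := @exists_root ('X^2 + 'X + 1).
  by rewrite -addrA -polyC1 size_polyDl size_polyXn ?size_XaddC.
rewrite !hornerE => E; exists w.
have E1 : 1 + w + w ^+ 2 = 0 by rewrite -[RHS]E; ring.
split=> //.
  apply/eqP; rewrite -subr_eq0; apply/eqP.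
  transitivity ((1 + w + w ^+ 2) * (w - 1)); first by ring.
  by rewrite E1 mul0r.
apply: contraNneq three_neq0 => w1; rewrite -E1 w1.
by apply/eqP; ring.
Qed.

Section Twists.
Variables (u v : F) (uv : curve_pair c u v).
Let onc : on_curve u v := cp_eqn uv.

Lemma cp_neq0 : u != 0 /\ v != 0.
Proof.
have Nv := cp_nonconst uv; have Nu := cp_nonconst (cp_swap two_neq0 uv).
split; [apply/eqP => E; apply: Nu|apply/eqP => E; apply: Nv];
  by exists 0; rewrite rmorph0.
Qed.

Lemma cp_twist w : w ^+ 3 = 1 -> curve_pair c (c w * u) v.
Proof.
move=> w3; have w0 : w != 0.
  by apply: contraTneq isT => w0; move: w3 => /eqP; rewrite w0 expr0n eq_sym oner_eq0.
split; first exact: (cp_nonconst uv).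
  by rewrite /on_curve exprMn -rmorphXn w3 rmorph1 mul1r; apply: onc.
move=> S Ss Su Sv; apply: (cp_gen uv Ss) => //.
rewrite -[u](mulKf (x := c w)) ?fmorph_eq0 // -fmorphV; apply: (sfM Ss) => //.
exact: sfC.
Qed.

Lemma cp_invert : curve_pair c u^-1 (- v).
Proof.
have [u0 v0] := cp_neq0; split.
- move=> [k E]; apply: (cp_nonconst uv); exists (- k).
  by rewrite rmorphN -E opprK.
- rewrite /on_curve; have -> : (1 + u^-1 ^+ 3) * (1 + (- v) ^+ 3) = (1 + u ^+ 3) * (1 - v ^+ 3) / u ^+ 3.
    by field.
  rewrite -(on_curve_cube onc) -onc; by field.
move=> S Ss Su Sv; apply: (cp_gen uv Ss); first by rewrite -[u]invrK; apply: (sfV Ss).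
by rewrite -[v]opprK; apply: (sfN Ss).
Qed.

Lemma cp_invert_base : curve_pair c (- u) v^-1.
Proof.
have [u0 v0] := cp_neq0; split.
- move=> [k E]; apply: (cp_nonconst uv); exists (k^-1).
  by rewrite fmorphV -E invrK.
- rewrite /on_curve; have -> : (1 + (- u) ^+ 3) * (1 + v^-1 ^+ 3) = (1 - u ^+ 3) * (1 + v ^+ 3) / v ^+ 3.
    by field.
  rewrite -(on_curve_cube (on_curve_sym onc)) -onc; by field.
move=> S Ss Su Sv; apply: (cp_gen uv Ss); last by rewrite -[v]invrK; apply: (sfV Ss).
by rewrite -[u]opprK; apply: (sfN Ss).
Qed.

Let D := curve_derivation uv.
Let Dd : const_derivation c D := curve_derivationP two_neq0 three_neq0 uv.
Let Dv : D v = - u ^+ 2 * (1 + v ^+ 3) := curve_derivation_v two_neq0 three_neq0 uv.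

Lemma Dv_neq0 : D v != 0.
Proof.
have [u0 v0] := cp_neq0.
by rewrite Dv mulf_neq0 ?oppr_eq0 ?expf_neq0 //; have [] := cp_neq two_neq0 uv.
Qed.

(** In this lemma and the next two, the factor of [regular_pullback] is read off by
    applying D and the automorphism to v: it is w^2, -1/u and -1/v respectively. *)
Lemma regular_twist w k (a : curve_aut c) : w ^+ 3 = 1 ->
  maps_to u v a (c w * u) v -> regular c D k -> regular c D (pullback a k).
Proof.
move=> w3 [au av] rk; have [s [s0 sE Hs]] := regular_pullback two_neq0 three_neq0 uv a Dd Dv_neq0.
have Es : s = c (w ^+ 2).
  apply: (mulIf Dv_neq0); have := sE v; rewrite av => <-.
  rewrite Dv !(rmorphM, rmorphN, rmorphXn, rmorphD, rmorph1) /= au av.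
  by ring.
rewrite -[pullback a k](divfK s0) mulrC Es; apply: regularZ; rewrite -Es; exact: Hs.
Qed.

Lemma regular_invert k (a : curve_aut c) :
  maps_to u v a u^-1 (- v) -> regular c D k -> regular c D (- u * pullback a k).
Proof.
move=> [au av] rk; have [s [s0 sE Hs]] := regular_pullback two_neq0 three_neq0 uv a Dd Dv_neq0.
have [u0 v0] := cp_neq0.
have Es : s = - u^-1.
  apply: (mulIf Dv_neq0); have := sE v; rewrite av (cdN Dd) mulrN => /esym/eqP.
  rewrite eqr_oppLR => /eqP ->.
  rewrite Dv !(rmorphM, rmorphN, rmorphXn, rmorphD, rmorph1) /= au av.
  have -> : 1 + (- v) ^+ 3 = (1 + v ^+ 3) * u ^+ 3 by rewrite (on_curve_cube onc); ring.
  by field.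
by have := Hs k rk; rewrite Es invrN invrK mulrN mulNr mulrC.
Qed.

Lemma regular_invert_base k (a : curve_aut c) :
  maps_to u v a (- u) v^-1 -> regular c D k -> regular c D (- v * pullback a k).
Proof.
move=> [au av] rk; have [s [s0 sE Hs]] := regular_pullback two_neq0 three_neq0 uv a Dd Dv_neq0.
have [u0 v0] := cp_neq0.
have Es : s = - v^-1.
  have h : D v^-1 != 0 by rewrite (cdV Dd) mulf_neq0 ?oppr_eq0 ?Dv_neq0 ?invr_neq0 ?expf_neq0.
  apply: (mulIf h); have := sE v; rewrite av => <-.
  rewrite (cdV Dd) Dv !(rmorphM, rmorphN, rmorphXn, rmorphD, rmorph1) /= au av.
  by field.
by have := Hs k rk; rewrite Es invrN invrK mulrN mulNr mulrC.
Qed.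
End Twists.
End RegularBound.

(** * The space of regular differentials *)

Section RegularForm.
Variables (K : closedFieldType) (F : fieldType) (c : {rmorphism K -> F}).
Hypothesis two_neq0 : (2%:R : K) != 0.
Hypothesis three_neq0 : (3%:R : K) != 0.
Variables (u v : F) (uv : curve_pair c u v).
Let onc : on_curve u v := cp_eqn uv.
Let D := curve_derivation uv.
Local Notation e := (ev1 c v).

(** Regularity passes to the components along 1, u, u^2: these are the eigencomponents
    for the automorphism u -> w u, w a cube root of unity, so they are linear
    combinations of three conjugates. *)
Lemma eigen_components f0 f1 f2 :
  regular c D (f0 + f1 * u + f2 * u ^+ 2) ->
  (forall a : curve_aut c, pullback a v = v -> [/\ pullback a f0 = f0,
     pullback a f1 = f1 & pullback a f2 = f2]) ->
  [/\ regular c D f0, regular c D (f1 * u) & regular c D (f2 * u ^+ 2)].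
Proof.
move=> rk fix_; have [w [w3 w1 Ew]] := cube_root_of_unity three_neq0.
have [a [au av]] := coord_aut two_neq0 three_neq0 uv (cp_twist uv w3).
have [a0 a1 a2] := fix_ a av.
have Tw k : regular c D k -> regular c D (pullback a k) by exact: (regular_twist two_neq0 three_neq0 w3 (conj au av)).
have r1 := Tw _ rk; have r2 := Tw _ r1.
have w4 : w ^+ 2 * w ^+ 2 = w.
  by transitivity (w ^+ 3 * w); [ring|rewrite w3 mul1r].
have cw3 : c w ^+ 3 = 1 by rewrite -rmorphXn w3 rmorph1.
have cw4 : c w ^+ 2 * c w ^+ 2 = c w by rewrite -rmorphXn -rmorphM w4.
have wE : c w ^+ 2 = - 1 - c w.
  rewrite -rmorphXn -(rmorph1 c) -rmorphN -rmorphB; congr (c _).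
  by apply/eqP; rewrite -subr_eq0; apply/eqP; rewrite -[RHS]Ew; ring.
have aE k0 k1 k2 : pullback a (c k0 * f0 + c k1 * f1 * u + c k2 * f2 * u ^+ 2) =
    c k0 * f0 + c (k1 * w) * f1 * u + c (k2 * w ^+ 2) * f2 * u ^+ 2.
  rewrite !(rmorphD (pullback a), rmorphXn (pullback a), rmorphM (pullback a)) /=.
  by rewrite !(pullback_const a) a0 a1 a2 au !(rmorphXn c, rmorphM c) /=; ring.
have E1 : pullback a (f0 + f1 * u + f2 * u ^+ 2) = f0 + c w * f1 * u + c w ^+ 2 * f2 * u ^+ 2.
  by have := aE 1 1 1; rewrite !mul1r rmorph1 !mul1r rmorphXn => ->.
have E2 : pullback a (pullback a (f0 + f1 * u + f2 * u ^+ 2)) =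
    f0 + c w ^+ 2 * f1 * u + c w * f2 * u ^+ 2.
  by have := aE 1 w (w ^+ 2); rewrite E1 rmorph1 !mul1r w4 -expr2 (rmorphXn c).
rewrite E1 in r1; rewrite E2 in r2.
have third k : regular c D (3%:R * k) -> regular c D k.
  move=> r; rewrite -[k](mulKf (three_neq0F c three_neq0)) -(rmorph_nat c 3) -fmorphV.
  by apply: regularZ; rewrite rmorph_nat.
have comb k0 k1 k2 := regularD (regularD (regularZ k0 rk) (regularZ k1 r1)) (regularZ k2 r2).
split; apply: third.
- have := comb 1 1 1; rewrite rmorph1 !mul1r wE.
  by congr (regular c D _); ring.
- have := comb 1 (w ^+ 2) w; rewrite rmorph1 !mul1r rmorphXn.
  congr (regular c D _); transitivity (f0 * (1 + c w + c w ^+ 2) + f1 * u * (1 + 2%:R * c w ^+ 3)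
    + f2 * u ^+ 2 * (1 + c w ^+ 2 * c w ^+ 2 + c w ^+ 2)); first by ring.
  by rewrite cw4 cw3 wE; ring.
have := comb 1 w (w ^+ 2); rewrite rmorph1 !mul1r rmorphXn.
congr (regular c D _); transitivity (f0 * (1 + c w + c w ^+ 2)
    + f1 * u * (1 + c w ^+ 2 + c w ^+ 2 * c w ^+ 2) + f2 * u ^+ 2 * (1 + 2%:R * c w ^+ 3)); first by ring.
by rewrite cw4 cw3 wE; ring.
Qed.

(** Here f is (a / q) u^(j - i). Where u is not 0, evaluate at the point. Where u = 0,
    the function v - al has order 3, so that a pole of a / q at al is not compensated
    by a power of u with exponent at most 2. *)
Lemma local_pole be al f (a q : {poly K}) (i j : nat) :
  on_curve be al -> local_at c u v be al f -> f * e q * u ^+ i = e a * u ^+ j ->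
  (j <= i.+2)%N -> q.[al] = 0 -> a.[al] = 0.
Proof.
move=> pt Of E ij q0; have [u0 v0] := cp_neq0 two_neq0 uv.
have [be0|be0] := eqVneq be 0; last first.
  have := local_vanish two_neq0 three_neq0 uv pt (G := q%:P * 'X ^+ i) (G' := a%:P * 'X ^+ j) Of.
  rewrite !(evE, evME) mulrA => /(_ E); rewrite /at_point !(evE, evME) /=.
  rewrite !(ev1_root idfun) /= q0 mul0r.
  by move=> /(_ erefl)/eqP; rewrite mulf_eq0 expf_eq0 (negPf be0) andbF orbF => /eqP.
have [q1 Eq] := root_factor q0.
pose g : {poly K} := - ('X ^+ 2 + 'X * al%:P + al%:P ^+ 2).
have al3 : al ^+ 3 = 1.
  move: pt; rewrite /on_curve be0 expr0n addr0 mul1r => h.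
  by apply: (addrI 1); rewrite h.
have t0 := t_neq0 uv al.
have Ec : c al ^+ 3 = 1 by rewrite -rmorphXn al3 rmorph1.
have E' : f * ev c u v (q1%:P * 'X ^+ (i.+3 - j) * (polP K)%:P) = ev c u v (a * g)%:P.
  rewrite !(evE, evME).
  apply: (mulfI t0); apply: (mulIf (expf_neq0 i u0)).
  transitivity (f * e q * u ^+ i * u ^+ (i.+3 - j) * (1 + v ^+ 3)).
    by rewrite Eq !(evE, evME); ring.
  rewrite E; have -> : e a * u ^+ j * u ^+ (i.+3 - j) * (1 + v ^+ 3) =
     e a * ((1 + v ^+ 3) * (u ^+ j * u ^+ (i.+3 - j))) by ring.
  rewrite -exprD subnKC; last exact: leqW.
  rewrite -[i.+3]addn3 exprD; transitivity (e a * ((1 + v ^+ 3) * u ^+ 3) * u ^+ i); first by ring.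
  rewrite (on_curve_cube onc) -[X in X - v ^+ 3]Ec; ring.
have := local_vanish two_neq0 three_neq0 uv pt Of E'; rewrite /at_point.
rewrite !(evE, evME) be0 expr0n subn_eq0 ltnNge ij /= !(mulr0, mul0r) => /(_ erefl)/eqP.
have -> : al ^+ 2 + al * al + al ^+ 2 = 3%:R * al ^+ 2 by ring.
have al0 : al != 0 by apply: contraTneq isT => h; move: al3 => /eqP; rewrite h expr0n eq_sym oner_eq0.
rewrite mulf_eq0 oppr_eq0 mulf_eq0 expf_eq0 (negPf al0) (negPf three_neq0) andbF !orbF.
by rewrite (ev1_root idfun) => /eqP.
Qed.

(** If al^3 = -1 then u is infinite where v = al, and the automorphism (1/u, -v) moves
    this point to u = 0, v = -al. *)
Lemma regular_no_pole (a q : {poly K}) (i : nat) al : (i <= 2)%N -> q != 0 ->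
  regular c D (e a / e q * u ^+ i) -> q.[al] = 0 -> a.[al] = 0.
Proof.
move=> i2 q0 rk qal; have [u0 v0] := cp_neq0 two_neq0 uv.
have q1 : e q != 0 by apply: contra_neq q0; apply: (ev1_eq0 uv).
have [al1|al1] := eqVneq (1 + al ^+ 3) 0; last first.
  have [be Ebe] := cube_root ((1 - al ^+ 3) / (1 + al ^+ 3)).
  have pt : on_curve be al.
    by rewrite /on_curve Ebe; field.
  have Of := regular_local two_neq0 three_neq0 pt rk.
  apply: (local_pole (i := 0) (j := i) pt Of) qal => //.
  by rewrite expr0 mulr1 mulrAC divfK.
have al3 : (- al) ^+ 3 = 1.
  have -> : (- al) ^+ 3 = 1 - (1 + al ^+ 3) by ring.
  by rewrite al1 subr0.
have pt : on_curve 0 (- al) by rewrite /on_curve al3; ring.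
have [b [bu bv]] := coord_aut two_neq0 three_neq0 uv (cp_invert two_neq0 uv).
have := regular_invert two_neq0 three_neq0 (conj bu bv) rk.
move=> /(regular_local two_neq0 three_neq0 pt) Of.
have neg p : e (p \Po - 'X) = ev1 c (- v) p.
  rewrite /ev1 map_comp_poly horner_comp rmorphN /= map_polyX.
  by rewrite hornerN hornerX.
have q2 : ev1 c (- v) q != 0 by rewrite -[- v]bv -pullback_ev1 fmorph_eq0.
suff : (- (a \Po - 'X)).[- al] = 0.
  rewrite hornerN horner_comp !hornerE opprK => /eqP.
  by rewrite oppr_eq0 => /eqP.
apply: (local_pole (q := q \Po - 'X) (i := i) (j := 1) pt Of) => //; last first.
  by rewrite horner_comp !hornerE opprK.
rewrite ev1N !neg !(rmorphXn (pullback b), fmorphV (pullback b), rmorphM (pullback b)) /=.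
rewrite !pullback_ev1 bu bv expr1 exprVn.
by move: (u ^+ i) (expf_neq0 i u0) => U U0; field; apply/andP.
Qed.

Lemma regular_polynomial (a q : {poly K}) (i : nat) : (i <= 2)%N -> q != 0 ->
  regular c D (e a / e q * u ^+ i) -> exists a', e a / e q = e a'.
Proof.
move=> i2; have [n] := ubnP (size q); elim: n a q => // n IH a q sq q0 rk.
have [sq1|/exists_root [al qal]] := eqVneq (size q) 1%N.
  have /size_poly1P [k k0 Eq] : size q == 1%N by apply/eqP.
  exists (k^-1 *: a); rewrite Eq -mul_polyC ev1M !ev1C fmorphV mulrC //.
have aal := regular_no_pole i2 q0 rk qal.
have [a1 Ea] := root_factor aal; have [q1 Eq] := root_factor qal.
have t0 := t_neq0 uv al.
have E : e a / e q = e a1 / e q1.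
  by rewrite Ea Eq !(evE, evME) invfM mulrACA mulfV ?mul1r.
have q10 : q1 != 0 by apply: contra_neq q0 => h; rewrite Eq h mulr0.
rewrite E; apply: IH; rewrite -?E // -ltnS; apply: leq_trans sq.
by rewrite Eq mulrC size_Mmonic ?monicXsubC // size_XsubC addn2.
Qed.

(** The reciprocal polynomial, used to evaluate at v = infinity. *)
Lemma reversal n (b : {poly K}) : (size b <= n.+1)%N ->
  exists R, R.[0] = b`_n /\ forall z : F, z != 0 -> ev1 c z R = z ^+ n * ev1 c z^-1 b.
Proof.
elim: n b => [|n IH] b sb.
  exists b; split=> [|z z0]; first by rewrite horner_coef0.
  by rewrite (size1_polyC sb) !ev1C expr0 mul1r.
have [b1 [k Eb]] : exists b1 k, b = b1 * 'X + k%:P.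
  elim/poly_ind: b {sb} => [|p k _]; first by exists 0, 0; rewrite mul0r addr0.
  by exists p, k.
have sb1 : (size b1 <= n.+1)%N.
  have [->|b10] := eqVneq b1 0; first by rewrite size_poly0.
  by move: sb; rewrite Eb size_MXaddC (negPf b10).
have [R [R0 RE]] := IH _ sb1; exists (R + k%:P * 'X ^+ n.+1); split=> [|z z0].
  by rewrite !hornerE R0 Eb coefD coefMX coefC /= expr0n mulr0.
by rewrite !(evE, evME) RE // Eb !(evE, evME) exprS; field.
Qed.

(** The automorphism (-u, 1/v) sends the points with v infinite to points with v = 0,
    where a regular function v b(1/v) forces b to have degree at most 1. *)
Lemma regular_degree (b : {poly K}) (i : nat) :
  regular c D (e b * u ^+ i) -> (size b <= 2)%N.
Proof.
move=> rk; have [u0 v0] := cp_neq0 two_neq0 uv.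
rewrite leqNgt; apply/negP => sb.
have pt : on_curve (1 : K) 0 by rewrite /on_curve; ring.
have [a [au av]] := coord_aut two_neq0 three_neq0 uv (cp_invert_base two_neq0 uv).
have := regular_invert_base two_neq0 three_neq0 (conj au av) rk.
move=> /(regular_local two_neq0 three_neq0 pt) Of.
pose d := (size b - 3)%N.
have Ed : size b = d.+3 by rewrite -[d.+3]addn3 subnK.
have [|R [R0 RE]] := @reversal d.+2 b; first by rewrite Ed.
have := local_vanish two_neq0 three_neq0 uv pt (G := ('X ^+ d.+1)%:P) (G' := - R%:P * (- 'X) ^+ i) Of.
rewrite /at_point !(evE, evME) => /(_ _ _)/eqP.
rewrite expr0n (ev1_root idfun) R0 /= -[d.+2]/(d.+3.-1) -Ed -lead_coefE => h.
have /negP[] : lead_coef b != 0 by rewrite lead_coef_eq0 -size_poly_gt0 Ed.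
suff : - lead_coef b * (- 1) ^+ i == 0.
  by rewrite mulf_eq0 oppr_eq0 expf_eq0 oppr_eq0 oner_eq0 andbF orbF.
apply: h => //; rewrite RE // (rmorphM (pullback a)) (rmorphXn (pullback a)) /= pullback_ev1 au av.
by rewrite [v ^+ d.+2]exprS; ring.
Qed.

(** After the automorphism (1/u, -v) the function b(v) u^2 becomes b(-v) / u up to sign;
    regularity at the points with u = 0 and v^3 = 1 gives b the roots -1 and -w. *)
Lemma regular_top (b : {poly K}) : (size b <= 2)%N ->
  regular c D (e b * u ^+ 2) -> b = 0.
Proof.
move=> sb rk; have [u0 v0] := cp_neq0 two_neq0 uv.
have [w [w3 w1 Ew]] := cube_root_of_unity three_neq0.
have [a [au av]] := coord_aut two_neq0 three_neq0 uv (cp_invert two_neq0 uv).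
have r := regular_invert two_neq0 three_neq0 (conj au av) rk.
have rt k : k ^+ 3 = 1 -> root b (- k).
  move=> k3; have pt : on_curve 0 k by rewrite /on_curve k3; ring.
  have Of := regular_local two_neq0 three_neq0 pt r.
  have fE : - u * pullback a (e b * u ^+ 2) * u = - e (b \Po - 'X).
    rewrite (rmorphM (pullback a)) (rmorphXn (pullback a)) /= pullback_ev1 au av.
    have -> : e (b \Po - 'X) = ev1 c (- v) b.
      by rewrite /ev1 map_comp_poly horner_comp rmorphN /= map_polyX hornerN hornerX.
    by field.
  have := local_vanish two_neq0 three_neq0 uv pt (G := 'X) (G' := - (b \Po - 'X)%:P) Of.
  rewrite evN evC evX => /(_ fE); rewrite /at_point !(evE, evME) => /(_ erefl).
  by rewrite (ev1_root idfun) horner_comp !hornerE /= => /eqP; rewrite oppr_eq0.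
apply: (@roots_geq_poly_eq0 _ b [:: - 1; - w]) => //=.
  by rewrite !rt ?expr1n.
by rewrite inE eqr_opp eq_sym w1.
Qed.

Lemma regular_form k : regular c D k ->
  exists p0 p1 : {poly K}, [/\ (size p0 <= 2)%N, (size p1 <= 2)%N &
    k = e p0 + e p1 * u].
Proof.
have [a0 [a1 [a2 [q [q0 ->]]]]] := normal_form two_neq0 three_neq0 uv k.
rewrite ev_quad => rk.
have /eigen_components [] : regular c D (e a0 / e q + e a1 / e q * u + e a2 / e q * u ^+ 2).
- by move: rk; congr (regular c D _); ring.
- by move=> a av; rewrite !rmorphM !fmorphV /= !pullback_ev1 av.
move=> r0 r1 r2; rewrite -[e a0 / _]mulr1 -(expr0 u) in r0; rewrite -[u]expr1 in r1.
have [b0 E0] := regular_polynomial (isT : 0 <= 2)%N q0 r0.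
have [b1 E1] := regular_polynomial (isT : 1 <= 2)%N q0 r1.
have [b2 E2] := regular_polynomial (isT : 2 <= 2)%N q0 r2.
rewrite E0 in r0; rewrite E1 in r1; rewrite E2 in r2.
have s2 := regular_degree r2.
exists b0, b1; split; [exact: regular_degree r0|exact: regular_degree r1|].
rewrite -E0 -E1; have := E2; rewrite (regular_top s2 r2) ev1_0 => z.
transitivity (e a0 / e q + e a1 / e q * u + e a2 / e q * u ^+ 2); first by ring.
by rewrite z mul0r addr0.
Qed.
End RegularForm.

(** * Automorphisms act by fractional linear substitutions *)

Section Mobius.
Variables (K : closedFieldType) (F : fieldType) (c : {rmorphism K -> F}).
Hypothesis two_neq0 : (2%:R : K) != 0.
Hypothesis three_neq0 : (3%:R : K) != 0.

Definition mobius (f z : F) : Prop := exists k l m n : K,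
  c m * z + c n != 0 /\ f * (c m * z + c n) = c k * z + c l.

Lemma ev1_size2 z (p : {poly K}) : (size p <= 2)%N ->
  ev1 c z p = c p`_1 * z + c p`_0.
Proof.
move=> sp; have {1}-> : p = (p`_1)%:P * 'X + (p`_0)%:P.
  apply/polyP => -[|[|i]]; rewrite coefD coefMX !coefC ?add0r ?addr0 //.
  by rewrite /= nth_default // (leq_trans sp).
by rewrite !(evE, evME).
Qed.

Section Pair.
Variables (u v : F) (uv : curve_pair c u v).
Local Notation e := (ev1 c v).

(** f is a quotient of two elements of K[v] + K[v] u; if the coefficient pairs are
    proportional, the factor containing u cancels. *)
Lemma proportional_mobius f (p0 q0 p1 q1 : {poly K}) :
  (size p0 <= 2)%N -> (size q0 <= 2)%N -> (size p1 <= 2)%N -> (size q1 <= 2)%N ->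
  e p0 + e q0 * u != 0 -> f * (e p0 + e q0 * u) = e p1 + e q1 * u ->
  p0 * q1 = p1 * q0 -> mobius f v.
Proof.
move=> sp0 sq0 sp1 sq1 L0 E /(congr1 e); rewrite !ev1M => h.
suff [p [q [sp sq q0' fE]]] : exists p q : {poly K}, [/\ (size p <= 2)%N, (size q <= 2)%N,
    e q != 0 & f * e q = e p].
  exists p`_1, p`_0, q`_1, q`_0; rewrite -!ev1_size2 //.
have [z|z] := eqVneq (e p0) 0; last first.
  exists p1, p0; split=> //; apply: (mulIf L0).
  by rewrite mulrAC E mulrDl mulrDr mulrAC mulrA [e q1 * _]mulrC h.
move: L0 h E; rewrite z !(mul0r, add0r) => L0 /esym/eqP.
have q00 : e q0 != 0 by apply: contraNneq L0 => ->; rewrite mul0r.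
rewrite mulf_eq0 (negPf q00) orbF => /eqP ->; rewrite add0r mulrA => E.
exists q1, q0; split=> //; apply: (mulIf _ E).
by apply: contraNneq L0 => ->; rewrite mulr0.
Qed.

(** Let L0, L1, L2, L3 in the span of 1, u, v, uv correspond to the images of the
    differentials 1, v, u, uv. Then L0 L3 = L1 L2, and writing Li = pi + qi u this
    implies (p0 q1 - p1 q0) (p0 q2 - p2 q0) = 0. Geometrically, the quadric is
    mapped to itself and each ruling goes to a ruling. *)
Lemma aut_mobius (a : curve_aut c) :
  mobius (pullback a v) v \/ mobius (pullback a u) v.
Proof.
have Dd := curve_derivationP two_neq0 three_neq0 uv.
have [s [s0 _ Hs]] := regular_pullback two_neq0 three_neq0 uv a Dd (Dv_neq0 two_neq0 three_neq0 uv).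
have [r0 r2 r1 r3] := basis_regular two_neq0 three_neq0 uv.
have form k rk := regular_form two_neq0 three_neq0 (Hs k rk).
have [p0 [q0 [sp0 sq0 E0]]] := form _ r0.
have [p1 [q1 [sp1 sq1 E1]]] := form _ r1.
have [p2 [q2 [sp2 sq2 E2]]] := form _ r2.
have [p3 [q3 [sp3 sq3 E3]]] := form _ r3.
rewrite rmorph1 div1r in E0; rewrite rmorphM in E3.
have L0 : e p0 + e q0 * u != 0 by rewrite -E0 invr_eq0.
have q3E : (e p0 + e q0 * u) * (e p3 + e q3 * u) = (e p1 + e q1 * u) * (e p2 + e q2 * u).
  by rewrite -E0 -E1 -E2 -E3; field.
have : ev c u v (quad (p0 * p3 - p1 * p2) (p0 * q3 + q0 * p3 - p1 * q2 - q1 * p2)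
    (q0 * q3 - q1 * q2)) = 0.
  rewrite ev_quad !evME; move/eqP: q3E; rewrite -subr_eq0 => /eqP <-; ring.
move=> /(quad_eq0 two_neq0 three_neq0 uv) [] /eqP; rewrite subr_eq0 => /eqP h0 h1 /eqP.
rewrite subr_eq0 => /eqP h2.
have : (p0 * q1 - p1 * q0) * (p0 * q2 - p2 * q0) = 0.
  transitivity (p0 ^+ 2 * (q1 * q2) + (p1 * p2) * q0 ^+ 2 - p0 * q0 * (p1 * q2 + q1 * p2)).
    by ring.
  rewrite -h0 -h2 -[RHS](mulr0 (p0 * q0)) -[in RHS]h1; ring.
move/eqP; rewrite mulf_eq0 !subr_eq0 => /orP [] /eqP h; [left|right].
  apply: (proportional_mobius sp0 sq0 sp1 sq1 L0 _ h).
  by rewrite -E0 -E1.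
apply: (proportional_mobius sp0 sq0 sp2 sq2 L0 _ h).
by rewrite -E0 -E2.
Qed.

Lemma linear_eq0 k0 k1 k2 k3 :
  c k0 + c k1 * v + (c k2 + c k3 * v) * u = 0 -> [/\ k0 = 0, k1 = 0, k2 = 0 & k3 = 0].
Proof.
have lin k l : k%:P + l *: 'X = 0 :> {poly K} -> k = 0 /\ l = 0.
  move=> h; split; [move/(congr1 (coefp 0)): h|move/(congr1 (coefp 1)): h];
  by rewrite /coefp !coefE /= ?mulr0 ?mulr1 ?addr0 ?add0r.
move=> E; have := @quad_eq0 _ _ _ two_neq0 three_neq0 _ _ uv (k0%:P + k1 *: 'X) (k2%:P + k3 *: 'X) 0.
rewrite ev_quad -!mul_polyC !(evE, evME) E mul0r addr0 => /(_ erefl) [].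
by rewrite !mul_polyC => /lin [-> ->] /lin [-> ->].
Qed.

Lemma mobius_exclusive f : ~ in_const c f -> mobius f v -> ~ mobius f u.
Proof.
move=> Nf [k [l [m [n [d0 E]]]]] [k' [l' [m' [n' [d0' E']]]]].
have : (c k * v + c l) * (c m' * u + c n') = (c k' * u + c l') * (c m * v + c n).
  by rewrite -E -E'; ring.
move/eqP; rewrite -subr_eq0 => /eqP h.
have /linear_eq0 [h0 h1 h2 h3] : c (l * n' - l' * n) + c (k * n' - l' * m) * v
    + (c (l * m' - k' * n) + c (k * m' - k' * m) * v) * u = 0.
  by rewrite -[RHS]h !(rmorphB, rmorphM) /=; ring.
have [m'0|m'0] := eqVneq m' 0.
  have n'0 : n' != 0.
    by apply: contraNneq d0' => ->; rewrite m'0 rmorph0 mul0r addr0.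
  apply: Nf; exists (l' / n'); apply: (mulIf d0); rewrite E.
  have cn : c n' != 0 by rewrite fmorph_eq0.
  move/(congr1 c): h0; move/(congr1 c): h1; rewrite rmorph0 !(rmorphB, rmorphM) /= fmorphV.
  move=> /eqP; rewrite subr_eq0 => /eqP h1' /eqP; rewrite subr_eq0 => /eqP h0'.
  apply: (mulIf cn); rewrite mulrDl mulrAC h1' h0'; field; exact: cn.
apply: Nf; exists (k' / m'); apply: (mulIf d0); rewrite E.
have cm : c m' != 0 by rewrite fmorph_eq0.
move/(congr1 c): h2; move/(congr1 c): h3; rewrite rmorph0 !(rmorphB, rmorphM) /= fmorphV.
move=> /eqP; rewrite subr_eq0 => /eqP h1' /eqP; rewrite subr_eq0 => /eqP h0'.
apply: (mulIf cm); rewrite mulrDl mulrAC h1' h0'; field; exact: cm.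
Qed.
End Pair.

Lemma pullback_nonconst (a : curve_aut c) z : ~ in_const c z -> ~ in_const c (pullback a z).
Proof.
move=> Nz [k E]; apply: Nz; exists k.
by apply: (fmorph_inj (pullback a)); rewrite /= E (pullback_const a).
Qed.

Lemma aut_mobius_pair u v (uv : curve_pair c u v) (a : curve_aut c) :
  (mobius (pullback a v) v /\ mobius (pullback a u) u) \/
  (mobius (pullback a v) u /\ mobius (pullback a u) v).
Proof.
have vu := cp_swap two_neq0 uv.
have Nv := pullback_nonconst (a := a) (cp_nonconst uv).
have Nu := pullback_nonconst (a := a) (cp_nonconst vu).
have [Mv|Mu] := aut_mobius uv a; have [Mu'|Mv'] := aut_mobius vu a; [by left| | |by right].
  by case: (mobius_exclusive uv Nv Mv Mv').
by case: (mobius_exclusive uv Nu Mu Mu').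
Qed.

(** (1 - f^3) / (1 + f^3) = g^3 lies in K(v), while g is fractional linear in u. The
    coefficient of u in the resulting relation over K(v) only vanishes if the
    substitution on u is diagonal or antidiagonal. *)
Lemma curve_mobius_monomial u v (uv : curve_pair c u v) f g :
  on_curve g f -> ~ in_const c f -> ~ in_const c g -> mobius f v -> mobius g u ->
  exists2 k : K, k != 0 & g = c k * u \/ g = c k / u.
Proof.
move=> gf Nf Ng [k [l [m [n [d0 E]]]]] [k' [l' [m' [n' [d0' E']]]]].
have onc := cp_eqn uv; have [u0 v0] := cp_neq0 two_neq0 uv.
have vP := (cp_neq two_neq0 uv).2.
pose U : {poly K} := (k%:P * 'X + l%:P) ^+ 3.
pose V : {poly K} := (m%:P * 'X + n%:P) ^+ 3.
have EU : ev1 c v U = f ^+ 3 * ev1 c v V.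
  by rewrite /U /V !(evE, evME) -E; ring.
have V0 : ev1 c v V != 0 by rewrite /V !(evE, evME) expf_neq0.
clearbody U V.
have cst (i j : K) : i *: (V - U) = j *: (V + U) -> i = 0 /\ j = 0.
  move/(congr1 (ev1 c v)); rewrite -!mul_polyC !(evE, evME) EU => h.
  have h' : c i * (1 - f ^+ 3) = c j * (1 + f ^+ 3) by apply: (mulIf V0); rewrite -!mulrA ?mulrBl ?mulrDl !mul1r.
  have [s0|s0] := eqVneq (i + j) 0.
    have Ej : j = - i by apply/eqP; rewrite -addr_eq0 addrC s0.
    move: h'; rewrite Ej rmorphN => h'.
    have : c i * 2%:R = 0 by rewrite -(subrr (c i * (1 - f ^+ 3))) {2}h'; ring.
    move/eqP; rewrite mulf_eq0 (negPf (two_neq0F c two_neq0)) orbF fmorph_eq0 => /eqP ->.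
    by rewrite oppr0.
  case: Nf; apply: (@const_root _ _ _ _ 3) => //; exists ((i - j) / (i + j)).
  have cs : c i + c j != 0 by rewrite -rmorphD fmorph_eq0.
  rewrite (rmorphM c) (fmorphV c) !(rmorphD c) (rmorphN c); apply: (mulIf cs); rewrite divfK //.
  transitivity (c i - c j - (c i * (1 - f ^+ 3) - c j * (1 + f ^+ 3))); first by ring.
  by rewrite h' subrr subr0.
have key : (1 - f ^+ 3) * (c m' * u + c n') ^+ 3 = (1 + f ^+ 3) * (c k' * u + c l') ^+ 3.
  by rewrite -E' -(on_curve_cube gf); ring.
have /(quad_eq0 two_neq0 three_neq0 uv) [_ h1 h2] : ev c u v (quad
   ((m' ^+ 3 *: (V - U) - k' ^+ 3 *: (V + U)) * polM K
     + (n' ^+ 3 *: (V - U) - l' ^+ 3 *: (V + U)) * polP K)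
   (((m' * n' ^+ 2) *: (V - U) - (k' * l' ^+ 2) *: (V + U)) * polP K *+ 3)
   (((m' ^+ 2 * n') *: (V - U) - (k' ^+ 2 * l') *: (V + U)) * polP K *+ 3)) = 0.
  rewrite ev_quad -!mul_polyC !(evE, evME) EU !(rmorphXn c, rmorphM c) /=.
  transitivity (ev1 c v V * (1 + v ^+ 3) * ((1 - f ^+ 3) * (c m' * u + c n') ^+ 3
     - (1 + f ^+ 3) * (c k' * u + c l') ^+ 3)); last by rewrite key subrr mulr0.
  by rewrite -(on_curve_cube onc); ring.
have cancel3 (A : {poly K}) : A * polP K *+ 3 = 0 -> A = 0.
  move/eqP; rewrite -mulr_natr mulf_eq0 mulf_eq0 (negPf (polP_neq0 K)) orbF.
  by rewrite -polyC_natr polyC_eq0 (negPf three_neq0) orbF => /eqP.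
have /cst [/eqP a1 /eqP b1] : (m' * n' ^+ 2) *: (V - U) = (k' * l' ^+ 2) *: (V + U).
  by apply/eqP; rewrite -subr_eq0; apply/eqP; exact: cancel3.
move: a1 b1; rewrite !mulf_eq0 !orbb.
have [m0|m0] := eqVneq m' 0; have [k0|k0] := eqVneq k' 0 => /=.
- move=> _ _; case: Ng; move: d0' E'; rewrite m0 k0 rmorph0 !mul0r !add0r => n0 E'.
  by exists (l' / n'); rewrite rmorphM fmorphV -E' mulfK.
- move=> _ /eqP l0; move: d0' E'; rewrite m0 l0 rmorph0 mul0r add0r addr0 fmorph_eq0 => n0 E'.
  exists (k' / n'); first by rewrite mulf_neq0 ?invr_eq0.
  have cn : c n' != 0 by rewrite fmorph_eq0.
  by left; apply: (mulIf cn); rewrite E' rmorphM fmorphV; field.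
- move=> /eqP n0 _; move: d0' E'; rewrite n0 k0 rmorph0 mul0r add0r addr0 => d0' E'.
  have l0 : l' != 0.
    apply/eqP => l0; case: Ng; exists 0; apply: (mulIf d0').
    by rewrite E' l0 rmorph0 mul0r.
  exists (l' / m'); first by rewrite mulf_neq0 ?invr_eq0.
  have cn : c m' != 0 by rewrite fmorph_eq0.
  by right; apply: (mulIf d0'); rewrite E' rmorphM fmorphV; field; apply/andP.
move=> /eqP n0 /eqP l0; case: Ng; move: d0' E'; rewrite n0 l0 rmorph0 !addr0 => d0' E'.
have cm : c m' != 0 by rewrite fmorph_eq0.
exists (k' / m'); apply: (mulIf d0'); rewrite E' rmorphM fmorphV; field; exact: cm.
Qed.
End Mobius.

Section SixthPower.
Variables (K : closedFieldType) (F : fieldType) (c : {rmorphism K -> F}).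
Hypothesis two_neq0 : (2%:R : K) != 0.
Hypothesis three_neq0 : (3%:R : K) != 0.

Lemma cube_linear_eq0 u v (uv : curve_pair c u v) k0 k1 k2 :
  c k0 + c k1 * v ^+ 3 + c k2 * v ^+ 6 = 0 -> [/\ k0 = 0, k1 = 0 & k2 = 0].
Proof.
move=> E; have /(ev1_eq0 uv) h : ev1 c v (k0%:P + k1%:P * 'X ^+ 3 + k2%:P * 'X ^+ 6) = 0.
  by rewrite !(evE, evME).
by split; [move/(congr1 (coefp 0)): h|move/(congr1 (coefp 3)): h|move/(congr1 (coefp 6)): h];
  rewrite /coefp !mul_polyC !coefE /= ?mulr0 ?mulr1 ?addr0 ?add0r.
Qed.

(** With f = k v or k / v and g = l u or l / u, comparing the equations for (g, f) and
    (u, v) as polynomials in v^3 gives k^3 = 1 or k^3 = -1 in each of the four cases. *)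
Lemma sixth_power u v (uv : curve_pair c u v) f g :
  on_curve g f -> ~ in_const c f -> ~ in_const c g -> mobius c f v -> mobius c g u ->
  f ^+ 6 = v ^+ 6 \/ f ^+ 6 = v^-1 ^+ 6.
Proof.
move=> gf Nf Ng Mf Mg; have [u0 v0] := cp_neq0 two_neq0 uv.
have onc := on_curve_cube (cp_eqn uv); set s := v ^+ 3 in onc.
have [k k0 Ef] := curve_mobius_monomial two_neq0 three_neq0 (cp_swap two_neq0 uv)
  (on_curve_sym gf) Ng Nf Mg Mf.
have [l l0 Eg] := curve_mobius_monomial two_neq0 three_neq0 uv gf Nf Ng Mf Mg.
have s0 : s != 0 by rewrite expf_neq0. have t0 : u ^+ 3 != 0 by rewrite expf_neq0.
have lin p q r : c p + c q * s + c r * s ^+ 2 = 0 -> [/\ p = 0, q = 0 & r = 0].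
  by rewrite -exprM => /(cube_linear_eq0 uv).
suff K2 : (k ^+ 3) ^+ 2 = 1.
  have ck : c k ^+ 6 = 1 by rewrite -rmorphXn (exprM k 3 2) K2 rmorph1.
  by case: Ef => ->; [left|right]; rewrite exprMn ck mul1r.
have two_cancel (a : K) : a *+ 2 = 0 -> a = 0.
  by move/eqP; rewrite -mulr_natr mulf_eq0 (negPf two_neq0) orbF => /eqP.
set kk := k ^+ 3; set ll := l ^+ 3.
have E : (1 + g ^+ 3) * (1 + f ^+ 3) = 2%:R := gf.
have Ek : c k ^+ 3 = c kk by rewrite -rmorphXn.
have El : c l ^+ 3 = c ll by rewrite -rmorphXn.
clearbody kk ll.
case: Ef Eg E => -> [] -> E; rewrite !exprMn ?exprVn Ek El -/s in E.
- have [h0 h1 h2] : [/\ 1 + ll - 2%:R = 0, (1 - ll) + kk * (1 + ll) - 2%:R = 0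
      & kk * (1 - ll) = 0].
    apply: lin.
    transitivity ((1 + c kk * s) * (1 + s + c ll * (1 - s)) - 2%:R * (1 + s)); first by ring.
    by rewrite -onc -E; ring.
  have Ell : ll = 1 by apply/eqP; rewrite -subr_eq0 -[X in _ == X]h0; apply/eqP; ring.
  have : (kk - 1) *+ 2 = 0 by rewrite -[RHS]h1 Ell; ring.
  by move=> /two_cancel/eqP; rewrite subr_eq0 => /eqP ->; rewrite expr1n.
- have [h0 h1 h2] : [/\ 1 + ll - 2%:R = 0, (ll - 1) + kk * (1 + ll) + 2%:R = 0
      & kk * (ll - 1) = 0].
    apply: lin.
    transitivity ((1 + c kk * s) * (1 - s + c ll * (1 + s)) - 2%:R * (1 - s)); first by ring.
    by rewrite -onc -E; field.
  have Ell : ll = 1 by apply/eqP; rewrite -subr_eq0 -[X in _ == X]h0; apply/eqP; ring.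
  have : (kk + 1) *+ 2 = 0 by rewrite -[RHS]h1 Ell; ring.
  by move=> /two_cancel/eqP; rewrite addr_eq0 => /eqP ->; rewrite sqrrN expr1n.
- have [h0 h1 h2] : [/\ kk * (1 + ll) = 0, (1 + ll) + kk * (1 - ll) - 2%:R = 0
      & 1 - ll - 2%:R = 0].
    apply: lin.
    transitivity ((s + c kk) * (1 + s + c ll * (1 - s)) - 2%:R * s * (1 + s)); first by ring.
    by rewrite -onc -E; field.
  have Ell : ll = - 1 by apply/eqP; rewrite -subr_eq0 -oppr_eq0 -[X in _ == X]h2; apply/eqP; ring.
  have : (kk - 1) *+ 2 = 0 by rewrite -[RHS]h1 Ell; ring.
  by move=> /two_cancel/eqP; rewrite subr_eq0 => /eqP ->; rewrite expr1n.
have [h0 h1 h2] : [/\ kk * (1 + ll) = 0, (1 + ll) + kk * (ll - 1) - 2%:R = 0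
    & ll - 1 + 2%:R = 0].
  apply: lin.
  transitivity ((s + c kk) * (1 - s + c ll * (1 + s)) - 2%:R * s * (1 - s)); first by ring.
  by rewrite -onc -E; field; apply/andP.
have Ell : ll = - 1 by apply/eqP; rewrite -subr_eq0 -[X in _ == X]h2; apply/eqP; ring.
have : (- kk - 1) *+ 2 = 0 by rewrite -[RHS]h1 Ell; ring.
move=> /two_cancel/eqP; rewrite subr_eq0 eqr_oppLR => /eqP ->.
by rewrite sqrrN expr1n.
Qed.

End SixthPower.

(** * From the plane equation to the cubic model *)

Section Coordinates.
Variables (K : closedFieldType) (F : fieldType) (c : {rmorphism K -> F}).
Hypothesis two_neq0 : (2%:R : K) != 0.
Hypothesis three_neq0 : (3%:R : K) != 0.

(** The invariant of the action of S_3 on the line by 1/z and -1/(z-1); it is the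
    j-invariant of the Legendre curve of parameter z, normalized to be 1 at -1. *)
Definition jinv (z : F) : F :=
  4%:R * (z ^+ 2 - z + 1) ^+ 3 / (27%:R * z ^+ 2 * (z - 1) ^+ 2).

Record curve_coords (x y : F) : Prop := CurveCoords {
  cc_x : ~ in_const c x;
  cc_y : ~ in_const c y;
  cc_eqn : jinv x + jinv y = 1;
  cc_gen : generates c x y }.

Lemma cc_swap x y : curve_coords x y -> curve_coords y x.
Proof. by case=> hx hy E g; split=> //; [rewrite addrC|apply: cp_gen_swap]. Qed.

Lemma nat4 : (4%:R : F) != 0.
Proof. by rewrite (natrM _ 2 2) mulf_neq0 // (two_neq0F c two_neq0). Qed.
Lemma nat27 : (27%:R : F) != 0.
Proof. by rewrite (natrM _ 3 9) (natrM _ 3 3) !mulf_neq0 // (three_neq0F c three_neq0). Qed.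

Lemma nonconst_sub x k : ~ in_const c x -> x - c k != 0.
Proof. by move=> Nx; rewrite subr_eq0; apply/eqP => E; apply: Nx; exists k. Qed.

Lemma nonconst_neq x : ~ in_const c x -> x != 0 /\ x - 1 != 0.
Proof.
move=> Nx; split; last by have := nonconst_sub 1 Nx; rewrite rmorph1.
by have := nonconst_sub 0 Nx; rewrite rmorph0 subr0.
Qed.

Lemma const_of_jinv x : x != 0 -> x - 1 != 0 -> in_const c (jinv x) -> in_const c x.
Proof.
move=> x0 x1 [k Ek].
pose p : {poly K} := 4%:R%:P * ('X ^+ 2 - 'X + 1) ^+ 3
  - (27%:R * k)%:P * 'X ^+ 2 * ('X - 1) ^+ 2.
apply: (@ev1_eq0_const _ _ c x p).
  apply/eqP => /(congr1 (horner^~ 0)); rewrite /p !hornerE /= => /eqP.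
  rewrite !(mulr0, mul0r, expr0n, subr0, oppr0, add0r, addr0, expr1n, mulr1) /=.
  by rewrite (natrM _ 2 2) mulf_eq0 (negPf two_neq0).
rewrite /p !(evE, evME) (rmorphM c) -Ek !rmorph_nat /jinv.
by field; rewrite x0 x1 nat27.
Qed.

(** If y were constant, x would be algebraic over K. This also excludes the values
    0 and 1 of y, for which the second term of the equation is 0 by convention. *)
Lemma function_field_coords x y : is_function_field c x y -> curve_coords x y.
Proof.
move=> [tr eqn gen].
have Nx : ~ in_const c x by move=> [k E]; apply: tr; rewrite E; apply: algebraic_id.
have CS := const_subfield c.
split=> //.
  have [x0 x1] := nonconst_neq Nx.
  move=> [k Ey]; apply: Nx; apply: const_of_jinv => //.
  have -> : jinv x = 1 - jinv y by rewrite -eqn /jinv addrK.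
  have Cn n : in_const c n%:R by exists n%:R; rewrite rmorph_nat.
  apply: (sfB CS); first exact: (sf1 CS).
  have Cy : in_const c y by exists k.
  rewrite /jinv; apply: (sfM CS).
    apply: (sfM CS) => //; apply: (sfX CS); apply: (sfD CS); last exact: (sf1 CS).
    by apply: (sfB CS) => //; apply: (sfX CS).
  apply: (sfV CS); apply: (sfM CS).
    by apply: (sfM CS) => //; apply: (sfX CS).
  by apply: (sfX CS); apply: (sfB CS) => //; apply: (sf1 CS).
move=> S SS Sx Sy z; have [G [H [_ ->]]] := gen z.
have S0 : S 0 by rewrite -(rmorph0 c); apply: (sfC SS).
have S1p t (p : {poly K}) : S t -> S (ev1 c t p).
  move=> St; elim/poly_ind: p => [|p k IH]; first by rewrite ev1_0.
  rewrite !(evE, evME); apply: (sfD SS); last exact: (sfC SS).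
  exact: (sfM SS).
have S2p p : S (ev c x y p).
  elim/poly_ind: p => [|p k IH]; first by rewrite ev_0.
  rewrite evD evM evC evX; apply: (sfD SS); last exact: S1p.
  exact: (sfM SS).
by apply: (sfM SS); [|apply: (sfV SS)]; apply: S2p.
Qed.

Variable (w : K).
Hypothesis (Ew : 1 + w + w ^+ 2 = 0).

Lemma cw2 : c w ^+ 2 = - 1 - c w.
Proof.
rewrite -rmorphXn -(rmorph1 c) -rmorphN -rmorphB; congr (c _).
by apply/eqP; rewrite -subr_eq0; apply/eqP; rewrite -[RHS]Ew; ring.
Qed.

(** (x + w) / (x + w^2), with w^2 = -1 - w: a coordinate a in which S_3 acts by the
    substitutions w^i a and w^i / a. *)
Definition cube_coord (x : F) : F := (x + c w) / (x - 1 - c w).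

Lemma cube_coord_den x : ~ in_const c x -> x - 1 - c w != 0 /\ x + c w != 0.
Proof.
move=> Nx; split.
  by have := nonconst_sub (1 + w) Nx; rewrite rmorphD rmorph1 opprD addrA.
by have := nonconst_sub (- w) Nx; rewrite rmorphN opprK.
Qed.

Lemma cube_coord_inv x : ~ in_const c x ->
  cube_coord x - 1 != 0 /\ x = (cube_coord x * (1 + c w) + c w) / (cube_coord x - 1).
Proof.
move=> Nx; have [d0 n0] := cube_coord_den Nx.
have t0 : 1 + 2%:R * c w != 0.
  apply/eqP => h; have := three_neq0F c three_neq0; rewrite -oppr_eq0.
  have -> : - 3%:R = (1 + 2%:R * c w) ^+ 2.
    transitivity (1 + 4%:R * c w + 4%:R * c w ^+ 2); last by ring.
    by rewrite cw2; ring.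
  by rewrite h expr0n eqxx.
have E : cube_coord x - 1 = (1 + 2%:R * c w) / (x - 1 - c w) by rewrite /cube_coord; field.
rewrite E mulf_neq0 ?invr_eq0 //; split=> //.
rewrite /cube_coord; apply/eqP; rewrite -subr_eq0; apply/eqP; field.
by rewrite t0 d0.
Qed.

Lemma cEw : 1 + c w + c w ^+ 2 = 0.
Proof. by rewrite cw2; ring. Qed.

Lemma jinv_cube_coord x : ~ in_const c x ->
  [/\ cube_coord x != 0, cube_coord x ^+ 3 - 1 != 0 &
      jinv x = - 4%:R * cube_coord x ^+ 3 / (cube_coord x ^+ 3 - 1) ^+ 2].
Proof.
move=> Nx; have [d0 n0] := cube_coord_den Nx; have [x0 x1] := nonconst_neq Nx.
have Nw : (1 + 2%:R * c w) ^+ 2 = - 3%:R.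
  transitivity (1 + 4%:R * c w + 4%:R * c w ^+ 2); first by ring.
  by rewrite cw2; ring.
have t3 := three_neq0F c three_neq0.
have t0 : 1 + 2%:R * c w != 0.
  by apply: contraNneq t3 => h; rewrite -oppr_eq0 -Nw h expr0n.
have E1 : cube_coord x ^+ 3 - 1 = 3%:R * (1 + 2%:R * c w) * x * (x - 1) / (x - 1 - c w) ^+ 3.
  transitivity ((1 + 2%:R * c w) * (3%:R * x * (x - 1) + (1 + c w + c w ^+ 2)) / (x - 1 - c w) ^+ 3).
    by rewrite /cube_coord; field.
  by rewrite cEw; ring.
split; first by rewrite mulf_neq0 ?invr_eq0.
  by rewrite E1 !mulf_neq0 // invr_eq0 expf_neq0.
have E2 : x ^+ 2 - x + 1 = (x + c w) * (x - 1 - c w).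
  transitivity ((x + c w) * (x - 1 - c w) + (1 + c w + c w ^+ 2)); first by ring.
  by rewrite cEw addr0.
have n27 := nat27; have n27' : - 27%:R != 0 :> F by rewrite oppr_eq0.
rewrite E1 /jinv E2 /cube_coord.
transitivity (- 4%:R * (x + c w) ^+ 3 * (x - 1 - c w) ^+ 3 /
   (9%:R * (1 + 2%:R * c w) ^+ 2 * x ^+ 2 * (x - 1) ^+ 2)).
  rewrite Nw; field; do ?[apply/andP; split] => //.
have n9 : 9%:R != 0 :> F by rewrite (natrM _ 3 3) mulf_neq0.
move: (x - 1) x1 (1 + 2%:R * c w) t0 (x - 1 - c w) d0 (x + c w) => Z Z0 T T0 Y Y0 X.
by field; do ?[apply/andP; split].
Qed.

(** This is - e / a where e^2 = - a^3, because of the relation between a and b that the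
    curve equation provides; hence its square is - a. *)
Definition angle (a b : F) : F :=
  - ((a ^+ 3 - 1) * (b ^+ 3 + 1) / (2%:R * (b ^+ 3 - 1))) / a.

(** The hypothesis is -4 a^3 / (a^3-1)^2 - 4 b^3 / (b^3-1)^2 = 1 with the denominators
    cleared. *)
Lemma angle_sq (a b : F) : a != 0 -> a ^+ 3 - 1 != 0 -> b ^+ 3 - 1 != 0 ->
  4%:R * a ^+ 3 * (b ^+ 3 - 1) ^+ 2 + 4%:R * b ^+ 3 * (a ^+ 3 - 1) ^+ 2
    + (a ^+ 3 - 1) ^+ 2 * (b ^+ 3 - 1) ^+ 2 = 0 ->
  angle a b ^+ 2 = - a.
Proof.
move=> a0 a1 b1 E; have t2 := two_neq0F c two_neq0.
apply/eqP; rewrite -subr_eq0; apply/eqP.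
transitivity ((4%:R * a ^+ 3 * (b ^+ 3 - 1) ^+ 2 + 4%:R * b ^+ 3 * (a ^+ 3 - 1) ^+ 2
    + (a ^+ 3 - 1) ^+ 2 * (b ^+ 3 - 1) ^+ 2) / (4%:R * a ^+ 2 * (b ^+ 3 - 1) ^+ 2)).
  by rewrite /angle; field; rewrite a0 b1 t2 nat4.
by rewrite E mul0r.
Qed.

Lemma angle_curve (a b : F) : a != 0 -> b != 0 -> a ^+ 3 - 1 != 0 -> b ^+ 3 - 1 != 0 ->
  4%:R * a ^+ 3 * (b ^+ 3 - 1) ^+ 2 + 4%:R * b ^+ 3 * (a ^+ 3 - 1) ^+ 2
    + (a ^+ 3 - 1) ^+ 2 * (b ^+ 3 - 1) ^+ 2 = 0 ->
  on_curve (angle a b) (angle b a).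
Proof.
move=> a0 b0 a1 b1 E; have t2 := two_neq0F c two_neq0.
have Eu : angle a b ^+ 2 = - a := angle_sq a0 a1 b1 E.
have Ev : angle b a ^+ 2 = - b by apply: angle_sq; rewrite // -[RHS]E; ring.
have u3 : angle a b ^+ 3 = - a * angle a b by rewrite exprSr Eu.
have v3 : angle b a ^+ 3 = - b * angle b a by rewrite exprSr Ev.
rewrite /on_curve u3 v3; apply/eqP; rewrite -subr_eq0; apply/eqP.
transitivity ((4%:R * a ^+ 3 * (b ^+ 3 - 1) ^+ 2 + 4%:R * b ^+ 3 * (a ^+ 3 - 1) ^+ 2
    + (a ^+ 3 - 1) ^+ 2 * (b ^+ 3 - 1) ^+ 2) / (4%:R * (a ^+ 3 - 1) * (b ^+ 3 - 1))).
  by rewrite /angle; field; rewrite ?a0 ?b0 ?a1 ?b1 ?t2 ?nat4.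
by rewrite E mul0r.
Qed.

Section CoordPair.
Variables (x y : F) (xy : curve_coords x y).
Let a := cube_coord x.
Let b := cube_coord y.
Definition ucoord := angle a b.
Definition vcoord := angle b a.

Lemma cube_coord_relation :
  4%:R * a ^+ 3 * (b ^+ 3 - 1) ^+ 2 + 4%:R * b ^+ 3 * (a ^+ 3 - 1) ^+ 2
    + (a ^+ 3 - 1) ^+ 2 * (b ^+ 3 - 1) ^+ 2 = 0.
Proof.
have [a0 a1 Ja] := jinv_cube_coord (cc_x xy); have [b0 b1 Jb] := jinv_cube_coord (cc_y xy).
have := cc_eqn xy; rewrite Ja Jb -/a -/b => E.
transitivity ((a ^+ 3 - 1) ^+ 2 * (b ^+ 3 - 1) ^+ 2 * (1 -
   (- 4%:R * a ^+ 3 / (a ^+ 3 - 1) ^+ 2 + - 4%:R * b ^+ 3 / (b ^+ 3 - 1) ^+ 2))).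
  by field; rewrite a1 b1.
by rewrite E subrr mulr0.
Qed.

Lemma ucoord_sq : ucoord ^+ 2 = - cube_coord x.
Proof.
have [a0 a1 _] := jinv_cube_coord (cc_x xy); have [b0 b1 _] := jinv_cube_coord (cc_y xy).
exact: angle_sq cube_coord_relation.
Qed.

Lemma vcoord_sq : vcoord ^+ 2 = - cube_coord y.
Proof.
have [a0 a1 _] := jinv_cube_coord (cc_x xy); have [b0 b1 _] := jinv_cube_coord (cc_y xy).
by apply: angle_sq; rewrite // -[RHS]cube_coord_relation; ring.
Qed.

Lemma cube_coord_const S t : closed_subfield c S -> ~ in_const c t -> S (cube_coord t) -> S t.
Proof.
move=> SS Nt Sm; have [_ ->] := cube_coord_inv Nt.
apply: (sfM SS); last by apply: (sfV SS); apply: (sfB SS) => //; apply: (sf1 SS).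
apply: (sfD SS); last exact: (sfC SS).
by apply: (sfM SS) => //; apply: (sfD SS); [apply: (sf1 SS)|apply: (sfC SS)].
Qed.

Lemma coords_curve_pair : curve_pair c ucoord vcoord.
Proof.
have [a0 a1 _] := jinv_cube_coord (cc_x xy); have [b0 b1 _] := jinv_cube_coord (cc_y xy).
split.
- move=> cv; apply: (cc_y xy); have CS := const_subfield c.
  apply: (cube_coord_const CS (cc_y xy)); rewrite -[cube_coord y]opprK -vcoord_sq.
  by apply: (sfN CS); apply: (sfX CS).
- exact: angle_curve cube_coord_relation.
move=> S SS Su Sv; apply: (cc_gen xy SS).
  apply: (cube_coord_const SS (cc_x xy)); rewrite -[cube_coord x]opprK -ucoord_sq.
  by apply: (sfN SS); apply: (sfX SS).
apply: (cube_coord_const SS (cc_y xy)); rewrite -[cube_coord y]opprK -vcoord_sq.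
by apply: (sfN SS); apply: (sfX SS).
Qed.

Lemma jinv_ucoord : jinv x = 4%:R * ucoord ^+ 6 / (1 + ucoord ^+ 6) ^+ 2.
Proof.
have [a0 a1 ->] := jinv_cube_coord (cc_x xy).
have E : ucoord ^+ 6 = - cube_coord x ^+ 3 by rewrite (exprM _ 2 3) ucoord_sq; ring.
have a1' : 1 - cube_coord x ^+ 3 != 0 by rewrite -oppr_eq0 opprB.
by rewrite E; field; do ?[apply/andP; split].
Qed.

End CoordPair.

Lemma vcoord_swap x y : vcoord x y = ucoord y x. Proof. by []. Qed.

Lemma coords_aut x y x' y' : curve_coords x y -> curve_coords x' y' ->
  exists a : curve_aut c, maps_to x y a x' y'.
Proof.
move=> xy xy'.
have [a [au av]] := coord_aut two_neq0 three_neq0 (coords_curve_pair xy) (coords_curve_pair xy').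
have inv t t' (Nt : ~ in_const c t) (Nt' : ~ in_const c t') :
    pullback a (cube_coord t) = cube_coord t' -> pullback a t = t'.
  move=> E; have [_ Et] := cube_coord_inv Nt; have [_ Et'] := cube_coord_inv Nt'.
  rewrite Et Et' -E !(fmorphV (pullback a), rmorphB (pullback a), rmorphD (pullback a),
    rmorphM (pullback a), rmorph1 (pullback a)) /=.
  by rewrite !(pullback_const a).
exists a; split; apply: inv; try exact: cc_x; try exact: cc_y.
- exact: (cc_x xy).
- exact: (cc_x xy').
- rewrite -[cube_coord x]opprK -(ucoord_sq xy) rmorphN rmorphXn /= au.
  by rewrite (ucoord_sq xy') opprK.
- exact: (cc_y xy).
- exact: (cc_y xy').
rewrite -[cube_coord y]opprK -(vcoord_sq xy) rmorphN rmorphXn /= av.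
by rewrite (vcoord_sq xy') opprK.
Qed.

(** The invariant of y is a function of v^6 unchanged under v -> 1/v. *)
Lemma aut_jinv x y (a : curve_aut c) : curve_coords x y ->
  jinv (pullback a y) = jinv y \/ jinv (pullback a y) = jinv x.
Proof.
move=> xy; have uv := coords_curve_pair xy; have vu := cp_swap two_neq0 uv.
set u := ucoord x y in uv vu; set v := vcoord x y in uv vu.
have Jx : jinv x = _ := jinv_ucoord xy.
have Jy : jinv y = _ := jinv_ucoord (cc_swap xy).
rewrite -vcoord_swap -/v in Jy; rewrite -/u in Jx.
have Ja : jinv (pullback a y) = 4%:R * pullback a v ^+ 6 / (1 + pullback a v ^+ 6) ^+ 2.
  have := congr1 (pullback a) Jy; rewrite /jinv.
  by rewrite !(fmorphV (pullback a), rmorphXn (pullback a), rmorphB (pullback a), rmorphD (pullback a),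
    rmorphM (pullback a), rmorph1 (pullback a), rmorph_nat (pullback a)) /=.
have gf : on_curve (pullback a u) (pullback a v).
  have := congr1 (pullback a) (cp_eqn uv).
  by rewrite !(rmorphXn (pullback a), rmorphD (pullback a),
    rmorphM (pullback a), rmorph1 (pullback a), rmorph_nat (pullback a)) /=.
have Nv := pullback_nonconst (a := a) (cp_nonconst uv).
have Nu := pullback_nonconst (a := a) (cp_nonconst vu).
have inv6 (t : F) : t != 0 -> 4%:R * t^-1 ^+ 6 / (1 + t^-1 ^+ 6) ^+ 2
    = 4%:R * t ^+ 6 / (1 + t ^+ 6) ^+ 2.
  move=> t0; have -> : 1 + t^-1 ^+ 6 = (1 + t ^+ 6) / t ^+ 6 by field.
  have [->|s0] := eqVneq (1 + t ^+ 6) 0; first by rewrite !(mul0r, expr0n, invr0, mulr0).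
  by field; rewrite s0 t0.
have [u0 v0] := cp_neq0 two_neq0 uv.
have [[Mv Mu]|[Mv Mu]] := aut_mobius_pair two_neq0 three_neq0 uv a; [left|right]; rewrite Ja.
  rewrite Jy; have [->//|->] := sixth_power two_neq0 three_neq0 uv gf Nv Nu Mv Mu.
  exact: inv6.
rewrite Jx; have [->//|->] := sixth_power two_neq0 three_neq0 vu gf Nv Nu Mv Mu.
exact: inv6.
Qed.

(** The invariant has degree 6, so the six transforms of x exhaust its fibre. *)
Lemma jinv_fiber z x : ~ in_const c z -> ~ in_const c x -> jinv z = jinv x ->
  z \in [:: x; 1 / x; 1 - x; 1 / (1 - x); (x - 1) / x; x / (x - 1)].
Proof.
move=> Nz Nx; have [z0 z1] := nonconst_neq Nz; have [x0 x1] := nonconst_neq Nx.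
have x1' : 1 - x != 0 by rewrite -oppr_eq0 opprB.
move=> E.
have : (z - x) * (z - 1 / x) * (z - (1 - x)) * (z - 1 / (1 - x)) *
   (z - (x - 1) / x) * (z - x / (x - 1)) = 0.
  transitivity (27%:R * z ^+ 2 * (z - 1) ^+ 2 / 4%:R * (jinv z - jinv x)).
    rewrite /jinv; field; rewrite ?x0 ?x1 ?x1' ?z0 ?z1 ?nat4 ?nat27; done.
  by rewrite E subrr mulr0.
by move/eqP; rewrite !mulf_eq0 !subr_eq0 !inE -!orbA.
Qed.
End Coordinates.

(** * Generated subgroups and the symmetric group on three letters *)

Section GeneratedSubgroups.
Local Open Scope group_scope.
Local Open Scope classical_set_scope.
Variable G : groupType.
Implicit Types S H : set G.

Lemma subgroupM H a b : is_subgroup H -> H a -> H b -> H (a * b).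
Proof.
move=> [H1 HV] Ha Hb; rewrite -[b]invgK; apply: (HV) => //.
by rewrite -[b^-1]mul1g; apply: HV.
Qed.

Lemma subgroup_gen_group S : is_subgroup (subgroup_gen S).
Proof.
split=> [H [[H1 _] _] //|a b Ha Hb H HS].
by have [[_ HV] _] := HS; apply: HV; [apply: Ha|apply: Hb].
Qed.

Lemma subgroup_gen_eq S H : is_subgroup H -> S `<=` H ->
  (forall a, H a -> subgroup_gen S a) -> subgroup_gen S = H.
Proof.
move=> Hg SH HS; apply/seteqP; split=> //; exact: smallest_sub.
Qed.

End GeneratedSubgroups.

Section SymmetricGroup3.
Definition o0 : 'I_3 := @Ordinal 3 0 isT.
Definition o1 : 'I_3 := @Ordinal 3 1 isT.
Definition o2 : 'I_3 := @Ordinal 3 2 isT.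

Lemma I3P (P : 'I_3 -> Prop) : P o0 -> P o1 -> P o2 -> forall i, P i.
Proof.
move=> P0 P1 P2 [[|[|[|//]]] lti]; first by rewrite (_ : Ordinal _ = o0) //; apply: val_inj.
  by rewrite (_ : Ordinal _ = o1) //; apply: val_inj.
by rewrite (_ : Ordinal _ = o2) //; apply: val_inj.
Qed.

Lemma S3_ext (s t : 'S_3) : s o0 = t o0 -> s o1 = t o1 -> s o2 = t o2 -> s = t.
Proof. by move=> h0 h1 h2; apply/permP; apply: I3P. Qed.

Lemma S3_exists (i j k : 'I_3) : uniq [:: i; j; k] ->
  exists s : 'S_3, [/\ s o0 = i, s o1 = j & s o2 = k].
Proof.
move=> U; have inj : injective (fun n : 'I_3 => nth o0 [:: i; j; k] n).
  move=> m n /eqP; rewrite nth_uniq ?ltn_ord // => /eqP; exact: val_inj.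
by exists (perm inj); split; rewrite permE.
Qed.

Lemma S3_values (P : 'I_3 -> 'I_3 -> 'I_3 -> Prop) :
  P o0 o1 o2 -> P o0 o2 o1 -> P o1 o0 o2 -> P o1 o2 o0 -> P o2 o0 o1 -> P o2 o1 o0 ->
  forall s : 'S_3, P (s o0) (s o1) (s o2).
Proof.
move=> h1 h2 h3 h4 h5 h6 s.
have n01 : s o0 != s o1 by rewrite (inj_eq perm_inj).
have n02 : s o0 != s o2 by rewrite (inj_eq perm_inj).
have n12 : s o1 != s o2 by rewrite (inj_eq perm_inj).
move: (s o0) (s o1) (s o2) n01 n02 n12.
by apply: I3P; apply: I3P; apply: I3P.
Qed.

Local Open Scope group_scope.
Lemma S3_words (r q s : 'S_3) :
  r o0 = o1 -> r o1 = o2 -> r o2 = o0 -> q o0 = o0 -> q o1 = o2 -> q o2 = o1 ->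
  s \in [:: 1; r; q; r * r; r * q; q * r].
Proof.
move=> r0 r1 r2 q0 q1 q2.
suff : [\/ s = 1, s = r | s = q] \/ [\/ s = r * r, s = r * q | s = q * r].
  by rewrite !inE; case=> [] [] ->; rewrite eqxx ?orbT.
have := @S3_values (fun i j k => forall t : 'S_3, t o0 = i -> t o1 = j -> t o2 = k ->
  [\/ t = 1, t = r | t = q] \/ [\/ t = r * r, t = r * q | t = q * r]).
move=> /(_ _ _ _ _ _ _ s s erefl erefl erefl); apply=> t t0 t1 t2.
- by left; constructor 1; apply: S3_ext; rewrite !perm1.
- by left; constructor 3; apply: S3_ext; rewrite ?q0 ?q1 ?q2.
- by right; constructor 3; apply: S3_ext; rewrite !permM ?q0 ?q1 ?q2 ?r0 ?r1 ?r2.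
- by left; constructor 2; apply: S3_ext; rewrite ?r0 ?r1 ?r2.
- by right; constructor 1; apply: S3_ext; rewrite !permM ?q0 ?q1 ?q2 ?r0 ?r1 ?r2 ?r0.
by right; constructor 2; apply: S3_ext; rewrite !permM ?r0 ?r1 ?r2 ?q0 ?q1 ?q2.
Qed.
End SymmetricGroup3.

(** * The anharmonic action of S_3 *)

Section Anharmonic.
Variables (K : closedFieldType) (F : fieldType) (c : {rmorphism K -> F}).
Hypothesis two_neq0 : (2%:R : K) != 0.
Hypothesis three_neq0 : (3%:R : K) != 0.

(** The points 0, 1, z, permuted below by S_3; the affine ratio of the permuted triple
    gives the six anharmonic transforms of z, uniformly in the permutation. *)
Definition triple (z : F) (i : 'I_3) : F := nth 0 [:: 0; 1; z] i.
Definition anh (s : 'S_3) (z : F) : F :=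
  (triple z (s o2) - triple z (s o0)) / (triple z (s o1) - triple z (s o0)).

Lemma triple_sub z (i j : 'I_3) : ~ in_const c z -> i != j -> triple z i - triple z j != 0.
Proof.
move=> Nz; have [z0 z1] := nonconst_neq Nz.
have z1' : 1 - z != 0 by rewrite -oppr_eq0 opprB.
move: i j; apply: I3P; apply: I3P; rewrite // /triple /= => _;
  by rewrite ?subr0 ?sub0r ?oppr_eq0 ?oner_neq0.
Qed.

Lemma triple_anh s z i : ~ in_const c z -> triple (anh s z) i =
  (triple z (s i) - triple z (s o0)) / (triple z (s o1) - triple z (s o0)).
Proof.
move=> Nz; move: i; apply: I3P => //; first by rewrite subrr mul0r.
by rewrite mulfV // triple_sub // (inj_eq perm_inj).
Qed.

(** 0, 1 and the transform of z are the image of the permuted triple under an affine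
    map, and affine maps preserve the ratio. *)
Lemma anhM s t z : ~ in_const c z -> anh t (anh s z) = anh (t * s)%g z.
Proof.
move=> Nz; rewrite {1}/anh !triple_anh // /anh !permM.
have h1 := triple_sub Nz (_ : s o1 != s o0).
have h2 := triple_sub Nz (_ : s (t o1) != s (t o0)).
by field; rewrite ?h1 ?h2 // !(inj_eq perm_inj).
Qed.

Lemma anh1 z : anh 1%g z = z.
Proof. by rewrite /anh !perm1 /triple /= !subr0 divr1. Qed.

Lemma anh_values s z :
  anh s z \in [:: z; 1 / z; 1 - z; 1 / (1 - z); (z - 1) / z; z / (z - 1)].
Proof.
rewrite /anh; apply: (S3_values (P := fun i j k => (triple z k - triple z i) /
  (triple z j - triple z i) \in _)); rewrite /triple /=
  ?subr0 ?sub0r ?divr1 ?inE ?eqxx ?orbT //.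
- by rewrite invrN1 mulrN1 opprB eqxx !orbT.
- have -> : - 1 / (z - 1) = 1 / (1 - z) by rewrite -(opprB 1 z) invrN mulrNN.
  by rewrite eqxx !orbT.
- have -> : (1 - z) / - z = (z - 1) / z by rewrite -(opprB z 1) invrN mulrNN.
  by rewrite eqxx !orbT.
have -> : - z / (1 - z) = z / (z - 1) by rewrite -(opprB z 1) invrN mulrNN.
by rewrite eqxx !orbT.
Qed.
End Anharmonic.

Section AnharmonicAction.
Variables (K : closedFieldType) (F : fieldType) (c : {rmorphism K -> F}).
Hypothesis two_neq0 : (2%:R : K) != 0.
Hypothesis three_neq0 : (3%:R : K) != 0.

Lemma anh_closed S s z : closed_subfield c S -> S z -> S (anh s z).
Proof.
move=> SS Sz; have ST i : S (triple z i).
  move: i; apply: I3P => //; rewrite /triple /=; last exact: (sf1 SS).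
  by rewrite -(rmorph0 c); apply: (sfC SS).
by apply: (sfM SS); [|apply: (sfV SS)]; apply: (sfB SS).
Qed.

Lemma anhK s z : ~ in_const c z -> anh s^-1%g (anh s z) = z.
Proof. by move=> Nz; rewrite (anhM _ _ Nz) mulVg anh1. Qed.

Lemma anh_nonconst s z : ~ in_const c z -> ~ in_const c (anh s z).
Proof.
move=> Nz cz; apply: (Nz); rewrite -(anhK s Nz).
by apply: anh_closed cz; apply: const_subfield.
Qed.

Lemma anh_surj (z z' : F) :
  z' \in [:: z; 1 / z; 1 - z; 1 / (1 - z); (z - 1) / z; z / (z - 1)] ->
  exists s, z' = anh s z.
Proof.
rewrite !inE; case/or4P => [/eqP ->|/eqP ->|/eqP ->|/or3P [] /eqP ->].
- by exists 1%g; rewrite anh1.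
- have [//|s [s0 s1 s2]] := @S3_exists o0 o2 o1; exists s.
  by rewrite /anh s0 s1 s2 /triple /= !subr0.
- have [//|s [s0 s1 s2]] := @S3_exists o1 o0 o2; exists s.
  by rewrite /anh s0 s1 s2 /triple /= sub0r invrN1 mulrN1 opprB.
- have [//|s [s0 s1 s2]] := @S3_exists o1 o2 o0; exists s.
  by rewrite /anh s0 s1 s2 /triple /= sub0r -(opprB 1 z) invrN mulrNN.
- have [//|s [s0 s1 s2]] := @S3_exists o2 o0 o1; exists s.
  by rewrite /anh s0 s1 s2 /triple /= sub0r -(opprB z 1) invrN mulrNN.
have [//|s [s0 s1 s2]] := @S3_exists o2 o1 o0; exists s.
by rewrite /anh s0 s1 s2 /triple /= sub0r -(opprB z 1) invrN mulrNN.
Qed.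

Lemma jinv_anh s z : ~ in_const c z -> jinv (anh s z) = jinv z.
Proof.
move=> Nz; have [z0 z1] := nonconst_neq Nz.
have z1' : 1 - z != 0 by rewrite -oppr_eq0 opprB.
have n27 := nat27 c three_neq0.
have h : 1 - (1 - z) != 0 by rewrite opprB addrC subrK.
have h1 : 1 - z - 1 != 0 by rewrite addrAC subrr sub0r oppr_eq0.
have h2 : 1 - (1 - z) = z by rewrite opprB addrC subrK.
have h3 : 1 + -1 * z != 0 by rewrite mulN1r.
have h4 : z - 1 + -1 * z != 0 by rewrite mulN1r addrAC subrr sub0r oppr_eq0 oner_neq0.
have h5 : z + -1 * (z - 1) != 0.
  by rewrite mulN1r opprB addrC subrK oner_neq0.
have := anh_values s z; rewrite !inE.
by case/or4P => [/eqP ->|/eqP ->|/eqP ->|/or3P [] /eqP ->] //; rewrite /jinv;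
  field; do ?[apply/andP; split].
Qed.

Lemma quadratic_const z (k0 k1 k2 : K) : ~ in_const c z ->
  c k0 + c k1 * z + c k2 * z ^+ 2 = 0 -> k1 = 0 /\ k2 = 0.
Proof.
move=> Nz E; pose p : {poly K} := k0%:P + k1%:P * 'X + k2%:P * 'X ^+ 2.
have p0 : p = 0.
  apply/eqP/negPn/negP => p0; apply: Nz; apply: (ev1_eq0_const p0).
  by rewrite /p !(evE, evME).
by split; [move/(congr1 (coefp 1)): p0|move/(congr1 (coefp 2)): p0];
  rewrite /coefp /p !mul_polyC !coefE /= ?mulr0 ?mulr1 ?addr0 ?add0r.
Qed.

(** Each nontrivial transform fixes only the roots of a polynomial of degree at most 2. *)
Lemma anh_eq_id s z : ~ in_const c z -> anh s z = z -> s = 1%g.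
Proof.
move=> Nz; have [z0 z1] := nonconst_neq Nz.
have z1' : 1 - z != 0 by rewrite -oppr_eq0 opprB.
have n1 : (1 : K) <> 0 by apply/eqP; apply: oner_neq0.
have n2 : (2%:R : K) <> 0 by apply/eqP.
have quad k0 k1 k2 : (k1 <> 0 \/ k2 <> 0) -> c k0 + c k1 * z + c k2 * z ^+ 2 = 0 -> False.
  by move=> h /(quadratic_const Nz) [? ?]; case: h.
have C : anh s z = z -> [/\ s o0 = o0, s o1 = o1 & s o2 = o2].
  rewrite /anh; apply: (S3_values (P := fun i j k =>
    (triple z k - triple z i) / (triple z j - triple z i) = z ->
    [/\ i = o0, j = o1 & k = o2])) => //; rewrite /triple /= ?subr0 ?sub0r => E; exfalso.
  - apply: (quad (-1) 0 1); first by right.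
    rewrite rmorphN rmorph1 rmorph0; transitivity (z * (z - 1 / z)); first by field.
    by rewrite E subrr mulr0.
  - apply: (quad (-1) 2%:R 0); first by left.
    rewrite rmorphN rmorph1 rmorph0 rmorph_nat; transitivity (z - (z - 1) / -1).
      by rewrite invrN1; ring.
    by rewrite E subrr.
  - apply: (quad 1 (-1) 1); first by right.
    rewrite rmorphN rmorph1; transitivity ((z - 1) * (z - -1 / (z - 1))); first by field.
    by rewrite E subrr mulr0.
  - apply: (quad 1 (-1) 1); first by right.
    rewrite rmorphN rmorph1; move: E; rewrite -(opprB z 1) invrN mulrNN => E.
    transitivity (z * (z - (z - 1) / z)); first by field.
    by rewrite E subrr mulr0.
  apply: (quad 0 (-2%:R) 1); first by right.
  rewrite rmorphN rmorph1 rmorph0 rmorph_nat; move: E.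
  rewrite -(opprB z 1) invrN mulrNN => E.
  transitivity ((z - 1) * (z - z / (z - 1))); first by field.
  by rewrite E subrr mulr0.
by case/C => h0 h1 h2; apply: S3_ext; rewrite perm1.
Qed.

Lemma anh_inj s t z : ~ in_const c z -> anh s z = anh t z -> s = t.
Proof.
move=> Nz E; have := anhK t Nz; rewrite -E (anhM _ _ Nz) => /(anh_eq_id Nz) h.
by rewrite -[s](mulKVg t) h mulg1.
Qed.

Lemma pullback_anh (a : curve_aut c) s z : pullback a (anh s z) = anh s (pullback a z).
Proof.
have T i : pullback a (triple z i) = triple (pullback a z) i.
  by move: i; apply: I3P => //; rewrite /triple /= ?rmorph0 ?rmorph1.
by rewrite /anh (rmorphM (pullback a)) (fmorphV (pullback a)) !(rmorphB (pullback a)) /= !T.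
Qed.

Lemma coords_anh x y s t : curve_coords c x y -> curve_coords c (anh s x) (anh t y).
Proof.
move=> [Nx Ny E g]; split; [exact: anh_nonconst|exact: anh_nonconst| |].
  by rewrite !jinv_anh.
move=> S SS Sx Sy; apply: (g S SS).
  by rewrite -(anhK s Nx); apply: anh_closed.
by rewrite -(anhK t Ny); apply: anh_closed.
Qed.

Lemma maps_to_inj x y (a b : curve_aut c) z t : generates c x y ->
  maps_to x y a z t -> maps_to x y b z t -> a = b.
Proof.
move=> g [ax ay] [bx b_y]; apply: curve_aut_pullback_inj; apply: g; rewrite ?ax ?ay //.
split=> [k|s r Es Er|s r Es Er|s Es]; first by rewrite !pullback_const.
- by rewrite !rmorphB /= Es Er.
- by rewrite !rmorphM /= Es Er.
by rewrite !fmorphV /= Es.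
Qed.
End AnharmonicAction.

(** * The automorphism group *)

Section AutomorphismGroup.
Local Open Scope group_scope.
Local Open Scope classical_set_scope.
Local Open Scope ring_scope.
Variables (K : closedFieldType) (F : fieldType) (c : {rmorphism K -> F}).
Hypothesis two_neq0 : (2%:R : K) != 0.
Hypothesis three_neq0 : (3%:R : K) != 0.
Variables (x y : F) (xy : curve_coords c x y).
Let Nx : ~ in_const c x := cc_x xy.
Let Ny : ~ in_const c y := cc_y xy.

Lemma coords_aut_exists x' y' : curve_coords c x' y' ->
  exists a : curve_aut c, maps_to x y a x' y'.
Proof.
move=> xy'; have [w [_ _ Ew]] := cube_root_of_unity three_neq0.
exact: (coords_aut two_neq0 three_neq0 Ew xy xy').
Qed.

Definition anh_aut (u : 'S_3 * 'S_3) : curve_aut c :=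
  projT1 (cid (coords_aut_exists (coords_anh three_neq0 u.1 u.2 xy))).

Lemma anh_autP u : maps_to x y (anh_aut u) (anh u.1 x) (anh u.2 y).
Proof. exact: projT2 (cid (coords_aut_exists (coords_anh three_neq0 u.1 u.2 xy))). Qed.

Definition swap_aut : curve_aut c := projT1 (cid (coords_aut_exists (cc_swap xy))).

Lemma swap_autP : maps_to x y swap_aut y x.
Proof. exact: projT2 (cid (coords_aut_exists (cc_swap xy))). Qed.

Lemma aut_eq (a b : curve_aut c) z t : maps_to x y a z t -> maps_to x y b z t -> a = b.
Proof. exact: (maps_to_inj (cc_gen xy)). Qed.

Lemma pullback_mulg (a b : curve_aut c) z :
  pullback (a * b)%g z = pullback b (pullback a z).
Proof. by []. Qed.

Lemma maps_to1 : maps_to x y (1%g : curve_aut c) x y.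
Proof. by []. Qed.

Lemma anh_aut1 : anh_aut 1%g = 1%g.
Proof.
by apply: aut_eq maps_to1; have [h1 h2] := anh_autP 1%g; split;
  rewrite ?h1 ?h2 anh1.
Qed.

Lemma anh_autM u v : (anh_aut u * anh_aut v)%g = anh_aut (u * v)%g.
Proof.
apply: (aut_eq _ (anh_autP _)); have [u1 u2] := anh_autP u; have [v1 v2] := anh_autP v.
split; rewrite pullback_mulg ?u1 ?u2 pullback_anh ?v1 ?v2.
  exact: (anhM _ _ Nx).
exact: (anhM _ _ Ny).
Qed.

Lemma anh_autV u : (anh_aut u)^-1%g = anh_aut u^-1%g.
Proof. by apply: (mulgI (anh_aut u)); rewrite mulgV anh_autM mulgV anh_aut1. Qed.

Lemma swap_aut_sq : (swap_aut * swap_aut)%g = 1%g.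
Proof.
by apply: aut_eq maps_to1; have [h1 h2] := swap_autP; split;
  rewrite pullback_mulg ?h1 ?h2.
Qed.

Lemma swap_autV : swap_aut^-1%g = swap_aut.
Proof. by apply: (mulgI swap_aut); rewrite mulgV swap_aut_sq. Qed.

Lemma anh_aut_swap u : (anh_aut u * swap_aut)%g = (swap_aut * anh_aut (u.2, u.1))%g.
Proof.
have [u1 u2] := anh_autP u; have [v1 v2] := anh_autP (u.2, u.1).
have [s1 s2] := swap_autP.
apply: (@aut_eq _ _ (anh u.1 y) (anh u.2 x)); split; rewrite pullback_mulg.
- by rewrite u1 pullback_anh s1.
- by rewrite u2 pullback_anh s2.
- by rewrite s1 v2.
by rewrite s2 v1.
Qed.

(** Otherwise x and y would have the same invariant, which would then be 1/2. *)
Lemma anh_neq_swap s t : anh s x <> anh t y.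
Proof.
move=> /(congr1 (@jinv F)); rewrite (jinv_anh three_neq0 _ Nx) (jinv_anh three_neq0 _ Ny) => E.
apply: Nx; have [x0 x1] := nonconst_neq Nx.
apply: (const_of_jinv two_neq0 three_neq0) => //; exists 2%:R^-1.
have t2 := two_neq0F c two_neq0.
rewrite fmorphV rmorph_nat; apply: (mulIf t2); rewrite mulVf // -[RHS](cc_eqn xy) -E; ring.
Qed.

Lemma anh_aut_neq_swap u v : anh_aut u <> (swap_aut * anh_aut v)%g.
Proof.
move=> E; have [u1 _] := anh_autP u; have [_ v2] := anh_autP v.
have [s1 _] := swap_autP.
apply: (@anh_neq_swap u.1 v.2); rewrite -u1 -v2 -s1 -pullback_mulg -E.
by [].
Qed.

Lemma anh_aut_inj : injective anh_aut.
Proof.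
move=> u v E; have [u1 u2] := anh_autP u; have [v1 v2] := anh_autP v.
rewrite E in u1 u2; case: u v u1 u2 v1 v2 {E} => [s t] [s' t'] /= u1 u2 v1 v2.
rewrite v1 in u1; rewrite v2 in u2.
by rewrite (anh_inj two_neq0 Nx u1) (anh_inj two_neq0 Ny u2).
Qed.

(** The invariants of x and y have sum 1, so they are both fixed or exchanged. *)
Lemma aut_classification (a : curve_aut c) :
  exists u, a = anh_aut u \/ a = (swap_aut * anh_aut u)%g.
Proof.
have [w [_ _ Ew]] := cube_root_of_unity three_neq0.
have Jsum : jinv (pullback a x) + jinv (pullback a y) = 1.
  have := congr1 (pullback a) (cc_eqn xy); rewrite /jinv.
  by rewrite !(fmorphV (pullback a), rmorphXn (pullback a), rmorphB (pullback a),
    rmorphD (pullback a), rmorphM (pullback a), rmorph1 (pullback a),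
    rmorph_nat (pullback a)) /=.
have Nax := pullback_nonconst (a := a) Nx; have Nay := pullback_nonconst (a := a) Ny.
have fiber z t : ~ in_const c z -> ~ in_const c t -> jinv z = jinv t -> exists s, z = anh s t.
  by move=> Nz Nt /(jinv_fiber two_neq0 three_neq0 Nz Nt)/anh_surj.
have [E|E] := aut_jinv two_neq0 three_neq0 Ew a xy.
  have E' : jinv (pullback a x) = jinv x.
    by apply: (addIr (jinv y)); rewrite (cc_eqn xy) -Jsum E.
  have [s Es] := fiber _ _ Nax Nx E'; have [t Et] := fiber _ _ Nay Ny E.
  by exists (s, t); left; apply: aut_eq (anh_autP _).
have E' : jinv (pullback a x) = jinv y.
  by apply: (addIr (jinv x)); rewrite [RHS]addrC (cc_eqn xy) -Jsum E.
have [s Es] := fiber _ _ Nax Ny E'; have [t Et] := fiber _ _ Nay Nx E.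
exists (t, s); right; apply: (@aut_eq _ _ (anh s y) (anh t x)) => //.
have [s1 s2] := swap_autP; have [v1 v2] := anh_autP (t, s).
by split; rewrite pullback_mulg ?s1 ?s2.
Qed.

Section Isomorphism.
Let to_aut (g : S3xS3_C2) : curve_aut c :=
  ((if g.1 == 1 then 1 else swap_aut) * anh_aut g.2)%g.

Lemma Z2_cases (b : 'Z_2) : b = 1%g \/ b = 1%R.
Proof.
by case: b => [[|[|//]] ltb]; [left|right]; apply: val_inj.
Qed.

Lemma to_autM : {morph to_aut : g h / (g * h)%g}.
Proof.
move=> g h; rewrite /to_aut.
have -> : (g * h)%g.1 = (g.1 * h.1)%g by [].
have -> : (g * h)%g.2 = (swap_act g.2 h.1 * h.2)%g by [].
have one1 : ((1%R : 'Z_2) == 1%g) = false by [].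
rewrite -anh_autM /swap_act.
case: (Z2_cases h.1) => ->; first by rewrite eqxx mulg1 mul1g !mulgA.
case: (Z2_cases g.1) => ->; rewrite ?mul1g ?eqxx ?one1.
  by rewrite [RHS]mulgA anh_aut_swap -mulgA.
rewrite -[RHS]mulgA [(anh_aut g.2 * _)%g]mulgA anh_aut_swap.
by rewrite !mulgA swap_aut_sq mul1g.
Qed.

Lemma sd_exists (b : 'Z_2) (u : 'S_3 * 'S_3) : exists g : S3xS3_C2, g.1 = b /\ g.2 = u.
Proof.
unshelve eexists (@SdPair _ _ _ _ swap_groupAction (b, u) _); last by [].
by rewrite !inE.
Qed.

Lemma to_aut_bij : exists2 f : curve_aut c -> S3xS3_C2, cancel f to_aut & cancel to_aut f.
Proof.
have surj a : exists g, to_aut g = a.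
  have [u [->|->]] := aut_classification a.
    by have [g [g1 g2]] := sd_exists 1%g u; exists g; rewrite /to_aut g1 g2 eqxx mul1g.
  by have [g [g1 g2]] := sd_exists 1%R u; exists g; rewrite /to_aut g1 g2.
have inj : injective to_aut.
  move=> g h; rewrite /to_aut => E; apply: val_inj; move: E.
  case: (g) (h) => [[b u] ?] [[b' v] ?] /=.
  have one1 : ((1%R : 'Z_2) == 1%g) = false by [].
  case: (Z2_cases b) => ->; case: (Z2_cases b') => ->; rewrite ?eqxx ?one1 ?mul1g.
  - by move/anh_aut_inj ->.
  - by move/anh_aut_neq_swap.
  - by move/esym/anh_aut_neq_swap.
  by move/mulgI/anh_aut_inj ->.
exists (fun a => projT1 (cid (surj a))) => [a|g]; first exact: projT2 (cid (surj a)).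
by apply: inj; exact: projT2 (cid (surj (to_aut g))).
Qed.

Lemma aut_isomorphic : isomorphic (curve_aut c) S3xS3_C2.
Proof.
have [f fK Kf] := to_aut_bij; exists f; first by exists to_aut.
by move=> a b; apply: (can_inj Kf); rewrite to_autM !fK.
Qed.
End Isomorphism.

(** A 3-cycle and a transposition generate S_3. *)
Lemma S3_generated (G : groupType) (phi : 'S_3 -> G) (r q : 'S_3) (S : set G) :
  r o0 = o1 -> r o1 = o2 -> r o2 = o0 -> q o0 = o0 -> q o1 = o2 -> q o2 = o1 ->
  phi 1%g = 1%g -> {morph phi : s t / (s * t)%g} -> S (phi r) -> S (phi q) ->
  forall s, subgroup_gen S (phi s).
Proof.
move=> r0 r1 r2 q0 q1 q2 phi1 phiM Sr Sq s.
have sub : S `<=` subgroup_gen S by exact: sub_gen_smallest.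
have gM a b := @subgroupM G _ a b (subgroup_gen_group S).
have g1 : subgroup_gen S 1%g by case: (subgroup_gen_group S).
have := S3_words s r0 r1 r2 q0 q1 q2; rewrite !inE.
case/or4P => [/eqP ->|/eqP ->|/eqP ->|/or3P [] /eqP ->]; rewrite ?phi1 ?phiM //;
  do ?[exact: sub|apply: gM].
Qed.

Lemma aut_structure : exists a1 a2 a3 a4 a5 : curve_aut c,
    [/\ maps_to x y a1 (- 1 / (x - 1)) y,
        maps_to x y a2 (1 / x) y,
        maps_to x y a3 x (- 1 / (y - 1)),
        maps_to x y a4 x (1 / y) &
        maps_to x y a5 y x] /\
    let H := subgroup_gen [set a1; a2; a3; a4; a5] in
    [/\ internal_dprod (subgroup_gen [set a1; a2]) (subgroup_gen [set a3; a4])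
          (subgroup_gen [set a1; a2; a3; a4]),
        internal_sdprod (subgroup_gen [set a1; a2; a3; a4])
          (subgroup_gen [set a5]) H,
        H = [set: curve_aut c] &
        isomorphic (curve_aut c) S3xS3_C2].
Proof.
have [//|r [r0 r1 r2]] := @S3_exists o1 o2 o0.
have [//|q [q0 q1 q2]] := @S3_exists o0 o2 o1.
have Er z : anh r z = - 1 / (z - 1) :> F by rewrite /anh r0 r1 r2 /triple /= sub0r.
have Eq z : anh q z = 1 / z :> F by rewrite /anh q0 q1 q2 /triple /= !subr0.
pose al (s : 'S_3) := anh_aut (s, 1%g); pose be (s : 'S_3) := anh_aut (1%g, s).
have al1 : al 1%g = 1%g by exact: anh_aut1.
have be1 : be 1%g = 1%g by exact: anh_aut1.
have alM : {morph al : s t / (s * t)%g}.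
  by move=> s t; rewrite /al anh_autM; congr (anh_aut (_, _)); rewrite mulg1.
have beM : {morph be : s t / (s * t)%g}.
  by move=> s t; rewrite /be anh_autM; congr (anh_aut (_, _)); rewrite mulg1.
have albe s t : anh_aut (s, t) = (al s * be t)%g.
  by rewrite /al /be anh_autM; congr (anh_aut (_, _)); rewrite ?mulg1 ?mul1g.
have beal s t : anh_aut (s, t) = (be t * al s)%g.
  by rewrite /al /be anh_autM; congr (anh_aut (_, _)); rewrite ?mulg1 ?mul1g.
exists (al r), (al q), (be r), (be q), swap_aut; split.
  split; [have := anh_autP (r, 1%g)|have := anh_autP (q, 1%g)|have := anh_autP (1%g, r)
    |have := anh_autP (1%g, q)|exact: swap_autP]; by rewrite /= anh1 ?Er ?Eq.
have imal : is_subgroup [set al s | s in [set: 'S_3]].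
  split=> [|_ _ [s _ <-] [t _ <-]]; first by exists 1%g.
  by exists (s * t^-1)%g => //; rewrite alM; congr (_ * _)%g;
    rewrite /al anh_autV; congr (anh_aut (_, _)); rewrite invg1.
have imbe : is_subgroup [set be s | s in [set: 'S_3]].
  split=> [|_ _ [s _ <-] [t _ <-]]; first by exists 1%g.
  by exists (s * t^-1)%g => //; rewrite beM; congr (_ * _)%g;
    rewrite /be anh_autV; congr (anh_aut (_, _)); rewrite invg1.
have imab : is_subgroup [set anh_aut u | u in [set: 'S_3 * 'S_3]].
  split=> [|_ _ [s _ <-] [t _ <-]]; first by exists 1%g => //; exact: anh_aut1.
  by exists (s * t^-1)%g => //; rewrite -anh_autM anh_autV.
have imsw : is_subgroup [set 1%g; swap_aut].
  split=> [|a b]; first by left.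
  by case=> -> [] ->; rewrite ?invg1 ?mulg1 ?mul1g ?swap_autV ?swap_aut_sq; [left|right|right|left].
have gen_al S : S (al r) -> S (al q) -> forall s, subgroup_gen S (al s).
  exact: (S3_generated r0 r1 r2 q0 q1 q2 al1 alM).
have gen_be S : S (be r) -> S (be q) -> forall s, subgroup_gen S (be s).
  exact: (S3_generated r0 r1 r2 q0 q1 q2 be1 beM).
have gen_ab S : S (al r) -> S (al q) -> S (be r) -> S (be q) ->
    forall u, subgroup_gen S (anh_aut u).
  move=> S1 S2 S3 S4 [s t]; rewrite albe; apply: (subgroupM (subgroup_gen_group S)).
    exact: gen_al.
  exact: gen_be.
have GA : subgroup_gen [set al r; al q] = [set al s | s in [set: 'S_3]].
  apply: subgroup_gen_eq => //; first by move=> _ [->|->]; [exists r|exists q].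
  by move=> _ [s _ <-]; apply: gen_al; [left|right].
have GB : subgroup_gen [set be r; be q] = [set be s | s in [set: 'S_3]].
  apply: subgroup_gen_eq => //; first by move=> _ [->|->]; [exists r|exists q].
  by move=> _ [s _ <-]; apply: gen_be; [left|right].
have GAB : subgroup_gen [set al r; al q; be r; be q]
    = [set anh_aut u | u in [set: 'S_3 * 'S_3]].
  apply: subgroup_gen_eq => //; first by move=> _ [[[->|->]|->]|->]; eexists => //.
  by move=> _ [u _ <-]; apply: gen_ab; [do 3!left|left; left; right|left; right|right].
have GS : subgroup_gen [set swap_aut] = [set 1%g; swap_aut].
  apply: subgroup_gen_eq => //.
  move=> _ [->|->]; first by case: (subgroup_gen_group [set swap_aut]).
  exact: sub_gen_smallest.
set S5 := [set al r; al q; be r; be q; swap_aut].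
have GH : subgroup_gen S5 = [set: curve_aut c].
  apply: subgroup_gen_eq => // a _.
  have gu u : subgroup_gen S5 (anh_aut u).
    by apply: gen_ab; [do 4!left|left; left; left; right|left; left; right|left; right].
  have [u [->|->]] := aut_classification a; first exact: gu.
  apply: (subgroupM (subgroup_gen_group S5)); last exact: gu.
  by apply: sub_gen_smallest; right.
split=> //; last exact: aut_isomorphic.
  rewrite GA GB GAB; split=> //.
  - by move=> _ _ [s _ <-] [t _ <-]; rewrite /commute -albe -beal.
  - apply/seteqP; split=> [_ [[s _ <-] [t _ /anh_aut_inj [<- _]]]|_ ->].
      by rewrite al1.
    by split; exists 1%g.
  apply/seteqP; split=> [_ [_ [_ [[s _ <-] [t _ <-] ->]]]|_ [[s t] _ <-]].
    by exists (s, t).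
  by exists (al s), (be t); split; [exists s|exists t|].
rewrite GAB GS GH; split=> //.
- move=> _ _ [u _ <-] [->|->]; first by exists u => //; rewrite conjg1.
  exists (u.2, u.1) => //; rewrite /conjg anh_aut_swap mulgA swap_autV.
  by rewrite swap_aut_sq mul1g.
- apply/seteqP; split=> [a [[u _ <-] [//|E]]|_ ->].
    by case: (@anh_aut_neq_swap u 1%g); rewrite anh_aut1 mulg1.
  by split; [exists 1%g => //; exact: anh_aut1|left].
apply/seteqP; split=> // a _.
have [u [->|->]] := aut_classification a.
  by exists (anh_aut u), 1%g; split; [exists u|left|rewrite mulg1].
exists (anh_aut (u.2, u.1)), swap_aut; split; [by exists (u.2, u.1)|by right|].
by rewrite anh_aut_swap; case: u.
Qed.
End AutomorphismGroup.

Local Open Scope classical_set_scope.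
Local Open Scope ring_scope.

Lemma prime_char_natr_neq0 (p : nat) (K : fieldType) (f : {rmorphism 'F_p -> K}) (n : nat) :
  prime p -> (0 < n < p)%N -> (n%:R : K) != 0.
Proof.
move=> pp /andP [n0 np]; rewrite -(rmorph_nat f) fmorph_eq0.
by rewrite -(dvdn_pcharf (pchar_Fp pp)) gtnNdvd.
Qed.

Theorem theorem2p9 (p : nat) (p_prime : prime p) (p_ge5 : (5 <= p)%N)
    (K : closedFieldType) (toK : {rmorphism 'F_p -> K})
    (toK_algebraic : integralRange toK)
    (F : fieldType) (c : {rmorphism K -> F}) (x y : F)
    (F_xy : is_function_field c x y) :
  exists a1 a2 a3 a4 a5 : curve_aut c,
    [/\ maps_to x y a1 (- 1 / (x - 1)) y,
        maps_to x y a2 (1 / x) y,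
        maps_to x y a3 x (- 1 / (y - 1)),
        maps_to x y a4 x (1 / y) &
        maps_to x y a5 y x] /\
    let H := subgroup_gen [set a1; a2; a3; a4; a5] in
    [/\ internal_dprod (subgroup_gen [set a1; a2]) (subgroup_gen [set a3; a4])
          (subgroup_gen [set a1; a2; a3; a4]),
        internal_sdprod (subgroup_gen [set a1; a2; a3; a4])
          (subgroup_gen [set a5]) H,
        H = [set: curve_aut c] &
        isomorphic (curve_aut c) S3xS3_C2].
Proof.
have two_neq0 : (2%:R : K) != 0.
  by apply: (prime_char_natr_neq0 toK p_prime); apply: leq_trans p_ge5.
have three_neq0 : (3%:R : K) != 0.
  by apply: (prime_char_natr_neq0 toK p_prime); apply: leq_trans p_ge5.
exact: (aut_structure two_neq0 three_neq0 (function_field_coords two_neq0 three_neq0 F_xy)).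
Qed.
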